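(* Let $p$ be a prime, let $q=p^e$, and let $A\in X\overline{\mathbb F}_p[[X]]$ be a non-zero algebraic series all of whose coefficients lie in the finite field $\mathbb F_q\subset\overline{\mathbb F}_p$. Then $$\kappa(\exp_!(A))\le q^{\kappa(A)-1}p^{q^{\kappa(A)}}\quad\text{and}\quad \kappa(\log_!(1+A))\le 1+4(\kappa(1+A))^p.$$
   Context: For $C=\sum_{n\ge0}\gamma_nX^n\in\overline{\mathbb F}_p[[X]]$ and integers $f\ge1$, $0\le k<p^f$, let $C_{k,f}=\sum_{n\ge0}\gamma_{k+np^f}X^n$. The $p$-kernel $\mathcal K(C)$ is the vector space spanned by $C$ and all $C_{k,f}$, and $\kappa(C)=\dim\mathcal K(C)$. The map $\exp_!$ is defined by: for $A=\sum_{n\ge1}\alpha_nX^n$, if $\exp(\sum_{n\ge1}\alpha_nX^n/n!)=1+\sum_{n\ge1}\beta_nX^n/n!$ (formally over $\mathbb Z$, the $\beta_n$ being integer polynomials in the $\alpha_i$), then $\exp_!(A)=1+\sum\beta_nX^n$; $\log_!$ is its inverse bijection $1+X\overline{\mathbb F}_p[[X]]\to X\overline{\mathbb F}_p[[X]]$. *)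

(* Defs.v *)
From HB Require Import structures.
From mathcomp Require Import all_boot all_order all_algebra.
From mathcomp Require Import boolp classical_sets.
From mathcomp Require Import mpoly zify.

Set Implicit Arguments.
Unset Strict Implicit.
Unset Printing Implicit Defensive.

Import GRing.Theory Num.Theory.

Local Open Scope ring_scope.
Local Open Scope classical_set_scope.

(* A record rather than a bare [nat -> R], because functions may carry the
   pointwise ring structure, whereas series are multiplied by convolution. *)
Record series (R : Type) := Series { scoef :> nat -> R }.

HB.instance Definition _ (R : Type) := gen_eqMixin (series R).
HB.instance Definition _ (R : Type) := gen_choiceMixin (series R).

Lemma seriesP (R : Type) (a b : series R) : a =1 b -> a = b.
Proof. by case: a b => [a] [b] /funext /= ->. Qed.

Section SeriesZmod.
Variable R : nzRingType.
Implicit Types a b c : series R.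

Definition addps a b : series R := Series (fun n => a n + b n).
Definition oppps a : series R := Series (fun n => - a n).
Definition zerops : series R := Series (fun=> 0).
Definition scaleps (x : R) a : series R := Series (fun n => x * a n).

Lemma addpsA : associative addps.
Proof. by move=> a b c; apply: seriesP => n /=; rewrite addrA. Qed.
Lemma addpsC : commutative addps.
Proof. by move=> a b; apply: seriesP => n /=; rewrite addrC. Qed.
Lemma add0ps : left_id zerops addps.
Proof. by move=> a; apply: seriesP => n /=; rewrite add0r. Qed.
Lemma addNps : left_inverse zerops oppps addps.
Proof. by move=> a; apply: seriesP => n /=; rewrite addNr. Qed.

HB.instance Definition _ := GRing.isZmodule.Build (series R)
  addpsA addpsC add0ps addNps.

Lemma scalepsA x y a : scaleps x (scaleps y a) = scaleps (x * y) a.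
Proof. by apply: seriesP => n /=; rewrite mulrA. Qed.
Lemma scale1ps : left_id 1 scaleps.
Proof. by move=> a; apply: seriesP => n /=; rewrite mul1r. Qed.
Lemma scalepsDr : right_distributive scaleps +%R.
Proof. by move=> x a b; apply: seriesP => n /=; rewrite mulrDr. Qed.
Lemma scalepsDl a : {morph scaleps^~ a : x y / x + y}.
Proof. by move=> x y; apply: seriesP => n /=; rewrite mulrDl. Qed.

HB.instance Definition _ := GRing.Zmodule_isLmodule.Build R (series R)
  scalepsA scale1ps scalepsDr scalepsDl.

Lemma scoefD a b n : (a + b) n = a n + b n. Proof. by []. Qed.
Lemma scoef0 n : (0 : series R) n = 0. Proof. by []. Qed.
Lemma scoefZ x a n : (x *: a) n = x * a n. Proof. by []. Qed.

Definition mulps a b : series R :=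
  Series (fun n => \sum_(i < n.+1) a i * b (n - i)%N).
Definition oneps : series R := Series (fun n => (n == 0%N)%:R).

Definition truncps (N : nat) a : {poly R} := \poly_(i < N) a i.

Lemma mulpsE N a b n : (n < N)%N ->
  mulps a b n = (truncps N a * truncps N b)`_n.
Proof.
move=> nN; rewrite coefM /=; apply: eq_bigr => -[i /= iN] _.
by rewrite !coef_poly !ifT //; apply: leq_ltn_trans nN; rewrite ?leq_subr.
Qed.

Lemma mulpsA : associative mulps.
Proof.
move=> a b c; apply: seriesP => n; rewrite !(mulpsE _ _ (ltnSn n)).
transitivity ((truncps n.+1 a * (truncps n.+1 b * truncps n.+1 c))`_n).
  rewrite [LHS]coefM [RHS]coefM; apply: eq_bigr => -[i /= iN] _; congr (_ * _).
  have h : (n - i < n.+1)%N by rewrite ltnS leq_subr.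
  by rewrite coef_poly h (mulpsE _ _ h).
rewrite mulrA [LHS]coefM [RHS]coefM; apply: eq_bigr => -[i /= iN] _.
by congr (_ * _); rewrite [in RHS]coef_poly iN (mulpsE _ _ iN).
Qed.

Lemma mul1ps : left_id oneps mulps.
Proof.
move=> a; apply: seriesP => n /=; rewrite big_ord_recl /= mul1r subn0 big1 ?addr0//.
by move=> i _; rewrite mul0r.
Qed.
Lemma mulps1 : right_id oneps mulps.
Proof.
move=> a; apply: seriesP => n /=; rewrite big_ord_recr /= subnn mulr1 big1 ?add0r//.
by move=> [i /= iN] _; rewrite subn_eq0 leqNgt iN mulr0.
Qed.
Lemma mulpsDl : left_distributive mulps +%R.
Proof.
move=> a b c; apply: seriesP => n /=; rewrite -big_split /=.
by apply: eq_bigr => i _; rewrite mulrDl.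
Qed.
Lemma mulpsDr : right_distributive mulps +%R.
Proof.
move=> a b c; apply: seriesP => n /=; rewrite -big_split /=.
by apply: eq_bigr => i _; rewrite mulrDr.
Qed.
Lemma oneps_neq0 : oneps != 0.
Proof.
by apply/eqP => /(congr1 (fun a : series R => a 0%N)) /eqP; rewrite oner_eq0.
Qed.

HB.instance Definition _ := GRing.Zmodule_isNzRing.Build (series R)
  mulpsA mul1ps mulps1 mulpsDl mulpsDr oneps_neq0.

Lemma scoefM a b n : (a * b) n = \sum_(i < n.+1) a i * b (n - i)%N.
Proof. by []. Qed.
Lemma scoef1 n : (1 : series R) n = (n == 0%N)%:R. Proof. by []. Qed.

Lemma scalepsAl x a b : x *: (a * b) = x *: a * b.
Proof.
apply: seriesP => n; rewrite scoefZ !scoefM mulr_sumr.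
by apply: eq_bigr => i _; rewrite mulrA.
Qed.

HB.instance Definition _ := GRing.Lmodule_isLalgebra.Build R (series R) scalepsAl.

Definition poly_series (P : {poly R}) : series R := Series (fun n => P`_n).

End SeriesZmod.

Lemma mulpsC (R : comNzRingType) : commutative (@mulps R).
Proof.
move=> a b; apply: seriesP => n; rewrite !(mulpsE _ _ (ltnSn n)).
by rewrite mulrC.
Qed.

HB.instance Definition _ (R : comNzRingType) :=
  GRing.PzRing_hasCommutativeMul.Build (series R) (@mulpsC R).

(* Algebraic over the field of rational functions; denominators have been
   cleared in the annihilating polynomial, which is a polynomial in Y with
   coefficients in K[X]. *)
Definition algebraic_series (K : fieldType) (A : series K) : Prop :=
  exists2 P : {poly {poly K}}, P != 0 & root (map_poly (@poly_series K) P) A.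

Section Dimension.
Variables (K : fieldType) (V : lmodType K).

Definition span_set (S : set V) : set V :=
  [set v | exists n (c : 'I_n -> K) (s : 'I_n -> V),
     (forall i, S (s i)) /\ v = \sum_(i < n) c i *: s i].

Definition lin_indep n (b : 'I_n -> V) : Prop :=
  forall c : 'I_n -> K, \sum_(i < n) c i *: b i = 0 -> forall i, c i = 0.

Definition has_dim (W : set V) (n : nat) : Prop :=
  exists2 b : 'I_n -> V, lin_indep b & W = span_set (range b).

Definition fin_dim (W : set V) : Prop := exists n, has_dim W n.

(* Meaningful only when [fin_dim W] holds (and 0 otherwise). *)
Definition dimension (W : set V) : nat := xget 0%N (has_dim W).

End Dimension.

Section Kernel.
Variables (p : nat) (K : fieldType).

Definition section (C : series K) (k f : nat) : series K :=
  Series (fun n => C (k + n * p ^ f)%N).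

Definition pkernel (C : series K) : set (series K) :=
  span_set [set D | D = C \/
    exists f k, [/\ (1 <= f)%N, (k < p ^ f)%N & D = section C k f]].

(* The dimension is over K itself; it is a natural number only when the kernel is
   finite-dimensional, see [dimension]. *)
Definition kappa (C : series K) : nat := dimension (pkernel C).

End Kernel.

(* Intended for S without constant term: then S ^+ k does not contribute to the coefficient
   of X^n for k > n, so that the exponential series may be truncated. *)
Definition exp_series (R : comAlgType rat) (S : series R) : series R :=
  Series (fun n => \sum_(k < n.+1) (k`!%:R : rat)^-1 *: (S ^+ k) n).

(* Only alpha_1, ..., alpha_n matter for beta_n, so the remaining variables are
   set to 0; the variable ['X_i] with i : 'I_n stands for alpha_(i+1). *)
Definition generic_egf (n : nat) : series {mpoly rat[n]} :=
  Series (fun m => \sum_(i < n | i.+1 == m) (m`!%:R : rat)^-1 *: 'X_i).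

Definition beta_rat (n : nat) : {mpoly rat[n]} :=
  n`!%:R * exp_series (generic_egf n) n.

Definition beta (n : nat) : {mpoly int[n]} :=
  xget 0 [set b | map_mpoly (fun z : int => z%:~R : rat) b = beta_rat n].

Section Exp.
Variable R : comAlgType rat.
Implicit Types a b S : series R.

Definition derivps a : series R := Series (fun n => a n.+1 *+ n.+1).

Lemma derivpsE a n : derivps a n = a n.+1 *+ n.+1. Proof. by []. Qed.

Lemma derivpsM a b : derivps (a * b) = derivps a * b + a * derivps b.
Proof.
apply: seriesP => n; rewrite scoefD !scoefM derivpsE.
rewrite [(a * b) _](mulpsE _ _ (ltnSn n.+1)) -coef_deriv derivM.
rewrite coefD !coefM; congr (_ + _); apply: eq_bigr => -[i /= iN] _.
  by rewrite coef_deriv !coef_poly !ifT //; lia.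
rewrite coef_deriv !coef_poly !ifT //; lia.
Qed.

Lemma derivpsX a k : derivps (a ^+ k) = derivps a * a ^+ k.-1 *+ k.
Proof.
elim: k => [|k IHk].
  by apply: seriesP => n; rewrite expr0 mulr0n /= mul0rn.
rewrite exprS derivpsM IHk.
case: k {IHk} => [|k] /=; first by rewrite mulr0n mulr0 addr0 mulr1n.
by rewrite mulrnAr mulrCA -exprS -mulrS.
Qed.

Lemma expps_low S k n : S 0%N = 0 -> (n < k)%N -> (S ^+ k) n = 0.
Proof.
move=> S0; elim: k n => // k IHk n nk; rewrite exprS scoefM.
rewrite big_ord_recl S0 mul0r add0r big1 // => -[i /= ilt] _.
by rewrite /bump /= IHk ?mulr0 //; lia.
Qed.

Lemma exp_seriesE S n N : S 0%N = 0 -> (n < N)%N ->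
  exp_series S n = \sum_(k < N) (k`!%:R : rat)^-1 *: (S ^+ k) n.
Proof.
move=> S0 nN /=.
rewrite (big_ord_widen N (fun k => (k`!%:R : rat)^-1 *: (S ^+ k) n))//.
rewrite [RHS](bigID (fun k : 'I_N => (k < n.+1)%N)) /=.
rewrite [X in _ + X]big1 ?addr0 //.
by move=> k; rewrite -leqNgt => nk; rewrite expps_low // scaler0.
Qed.

Lemma derivps_exp S : S 0%N = 0 ->
  derivps (exp_series S) = derivps S * exp_series S.
Proof.
move=> S0; apply: seriesP => n; rewrite scoefM.
under eq_bigr => i _.
  rewrite (@exp_seriesE _ _ n.+1) ?ltnS ?leq_subr// mulr_sumr.
  under eq_bigr do rewrite -scalerAr.
  over.
rewrite exchange_big /= big_ord_recl expr0 scoef1 scaler0 add0r -sumrMnl.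
apply: eq_bigr => k _; rewrite -scaler_sumr lift0.
have := congr1 (fun a : series R => a n) (derivpsX S k.+1).
have -> (T : series R) m j : (T *+ j) m = T m *+ j.
  by elim: j => // j IHj; rewrite mulrS scoefD IHj -mulrS.
rewrite derivpsE scoefM scalerMnr => ->; rewrite -scalerMnr scalerMnl.
congr (_ *: _); rewrite -mulr_natr.
by rewrite factS natrM invfM mulrAC mulVf ?mul1r // pnatr_eq0.
Qed.

End Exp.

Section Integrality.
Variable n : nat.

Let isint (x : {mpoly rat[n]}) : Prop :=
  exists b : {mpoly int[n]}, map_mpoly (fun z : int => z%:~R : rat) b = x.

Let isintD x y : isint x -> isint y -> isint (x + y).
Proof. by move=> [a <-] [b <-]; exists (a + b); rewrite raddfD. Qed.

Let isintM x y : isint x -> isint y -> isint (x * y).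
Proof. by move=> [a <-] [b <-]; exists (a * b); rewrite rmorphM. Qed.

Let isint0 : isint 0. Proof. by exists 0; rewrite raddf0. Qed.

Let isint1 : isint 1. Proof. by exists 1; rewrite rmorph1. Qed.

Let isintMn x k : isint x -> isint (x *+ k).
Proof. by move=> [a <-]; exists (a *+ k); rewrite raddfMn. Qed.

Let isintX i : isint 'X_i.
Proof. by exists 'X_i; rewrite map_mpolyX. Qed.

Let isint_egf m : isint (generic_egf n m *+ m`!).
Proof.
rewrite -sumrMnl; elim/big_ind: _ => // i /eqP im.
by rewrite -scaler_nat scalerA divff ?scale1r // pnatr_eq0 -lt0n fact_gt0.
Qed.

Let isint_exp m : isint (exp_series (generic_egf n) m *+ m`!).
Proof.
have e0 : generic_egf n 0%N = 0 by rewrite /= big1.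
elim/ltn_ind: m => -[_|m IHm].
  by rewrite /= big_ord_recl big_ord0 expr0 scoef1 invr1 scale1r addr0.
rewrite factS mulrnA -derivpsE derivps_exp // scoefM -sumrMnl.
elim/big_ind: _ => // i _.
have im : (i <= m)%N by rewrite -ltnS.
have gI : isint (derivps (generic_egf n) i *+ i`!).
  by rewrite derivpsE -mulrnA -factS; exact: isint_egf.
have hI : isint (exp_series (generic_egf n) (m - i)%N *+ (m - i)`!).
  by apply: IHm; rewrite ltnS leq_subr.
move: (derivps _ i) (exp_series _ _) gI hI => x y xI yI.
by rewrite -(bin_fact im) mulnC !mulrnA -mulrnAl -mulrnAr; apply/isintMn/isintM.
Qed.

Lemma betaP :
  map_mpoly (fun z : int => z%:~R : rat) (beta n) = beta_rat n.
Proof.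
have [b bE] := isint_exp n.
apply: (@xgetI _ 0 [set b | map_mpoly _ b = beta_rat n] b).
by rewrite /= bE /beta_rat mulr_natl.
Qed.

End Integrality.

Definition exp_fact (K : comNzRingType) (A : series K) : series K :=
  Series (fun n => mmap (fun z : int => z%:~R : K) (fun i : 'I_n => A i.+1)
                        (beta n)).

(* The inverse of the bijection [exp_fact] from X K[[X]] onto 1 + X K[[X]]; only
   its values on 1 + X K[[X]] are relevant. *)
Definition log_fact (K : comNzRingType) (B : series K) : series K :=
  xget 0 [set A : series K | A 0%N = 0 /\ exp_fact A = B].

(* Main.v *)
(** The series over K form a commutative ring for the shuffle product
(f g)_n = sum_i C(n, i) f_i g_(n-i), for which the shift f |-> f' is a derivation and
exp_! A is the solution of E' = A' E, E(0) = 1.  In characteristic p the iterate of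
order p of the shift is again a derivation, so the section f |-> f_(0,1) is a ring
morphism, and f^p is the constant f(0)^p.  Jacobson's formula gives
E^((p)) = (A^((p)) + A_1^p) E for this E, whence
exp_!(A)_(0,1) = exp_!(A_(0,1) + A_1^p X).

Exponential: let V be the p-kernel of A, of dimension k.  The shuffle algebra generated
by V is spanned by p^k monomials, because elements without constant term have zero p-th
power.  The products P exp_!(G + t X), with P in this algebra, G in V over F_q without
constant term, and t in F_q, are stable under sections, and there are at most q^(k-1)
such G; hence kappa(exp_! A) <= p^k q^k, which is at most the stated bound.

Logarithm: B = 1 + A has shuffle inverse B^(p-1), so (log_! B)' = B' B^(p-1).  The
iterated sections of C = log_! B either satisfy C' = D' D^(p-1) + c for some D in the
p-kernel V of B and a constant c, or are combinations of p-fold products of elements of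
V.  This leaves a space of dimension at most 1 + 2 k^p, where k = dim V.

Finiteness of kappa(A) is Christol's theorem: from a relation
sum_i P_i A^(p^i) = 0 with P_0 <> 0 one gets a finite-dimensional space containing A and
stable under the Cartier operators; on series over F_q these are the sections up to a
power of Frobenius. *)

Require Import Defs.
From HB Require Import structures.
From mathcomp Require Import all_boot all_order all_algebra.
From mathcomp Require Import boolp classical_sets.
From mathcomp Require Import finfield mpoly ring zify.

Set Implicit Arguments.
Unset Strict Implicit.
Unset Printing Implicit Defensive.

Import GRing.Theory Num.Theory.

Local Open Scope ring_scope.

(** * The shuffle ring *)

(** A type distinct from [series], whose ring structure is already the convolution product. *)
Record shuffle (R : Type) := Shuffle { shuf_coef :> nat -> R }.

HB.instance Definition _ (R : Type) := gen_eqMixin (shuffle R).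
HB.instance Definition _ (R : Type) := gen_choiceMixin (shuffle R).

Lemma shuffleP (R : Type) (f g : shuffle R) : f =1 g -> f = g.
Proof. by case: f g => [f] [g] /funext /= ->. Qed.

Definition shift (R : Type) (f : shuffle R) : shuffle R :=
  Shuffle (fun n => f n.+1).

Lemma shiftE (R : Type) (f : shuffle R) n : shift f n = f n.+1.
Proof. by []. Qed.

Section ShuffleRing.
Variable R : comNzRingType.
Implicit Types f g h : shuffle R.

Fact shuf_addA : associative (fun f g => Shuffle (fun n => f n + g n)).
Proof. by move=> f g h; apply: shuffleP => n /=; rewrite addrA. Qed.
Fact shuf_addC : commutative (fun f g => Shuffle (fun n => f n + g n)).
Proof. by move=> f g; apply: shuffleP => n /=; rewrite addrC. Qed.
Fact shuf_add0 :
  left_id (Shuffle (fun=> 0)) (fun f g => Shuffle (fun n => f n + g n)).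
Proof. by move=> f; apply: shuffleP => n /=; rewrite add0r. Qed.
Fact shuf_addN : left_inverse (Shuffle (fun=> 0))
  (fun f => Shuffle (fun n => - f n)) (fun f g => Shuffle (fun n => f n + g n)).
Proof. by move=> f; apply: shuffleP => n /=; rewrite addNr. Qed.

HB.instance Definition _ := GRing.isZmodule.Build (shuffle R)
  shuf_addA shuf_addC shuf_add0 shuf_addN.

Definition shuf_scale (x : R) f : shuffle R := Shuffle (fun n => x * f n).

Fact shuf_scaleA x y f : shuf_scale x (shuf_scale y f) = shuf_scale (x * y) f.
Proof. by apply: shuffleP => n /=; rewrite mulrA. Qed.
Fact shuf_scale1 : left_id 1 shuf_scale.
Proof. by move=> f; apply: shuffleP => n /=; rewrite mul1r. Qed.
Fact shuf_scaleDr : right_distributive shuf_scale +%R.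
Proof. by move=> x f g; apply: shuffleP => n /=; rewrite mulrDr. Qed.
Fact shuf_scaleDl f : {morph shuf_scale^~ f : x y / x + y}.
Proof. by move=> x y; apply: shuffleP => n /=; rewrite mulrDl. Qed.

HB.instance Definition _ := GRing.Zmodule_isLmodule.Build R (shuffle R)
  shuf_scaleA shuf_scale1 shuf_scaleDr shuf_scaleDl.

Lemma shufD f g n : (f + g) n = f n + g n. Proof. by []. Qed.
Lemma shufN f n : (- f) n = - f n. Proof. by []. Qed.
Lemma shufZ (x : R) f n : (x *: f) n = x * f n. Proof. by []. Qed.

Definition shuf_mul f g : shuffle R :=
  Shuffle (fun n => \sum_(i < n.+1) f i * g (n - i)%N *+ 'C(n, i)).
Definition shuf_one : shuffle R := Shuffle (fun n => (n == 0%N)%:R).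

Fact shiftD f g : shift (f + g) = shift f + shift g.
Proof. exact: shuffleP. Qed.

Fact shuf_mul_at0 f g : shuf_mul f g 0%N = f 0%N * g 0%N.
Proof. by rewrite /= big_ord_recl big_ord0 bin0 mulr1n addr0. Qed.

(** Pascal's rule for the binomial coefficients. *)
Fact shift_shuf_mul f g :
  shift (shuf_mul f g) = shuf_mul (shift f) g + shuf_mul f (shift g).
Proof.
apply: shuffleP => n; rewrite shiftE shufD /= big_ord_recl /=.
under eq_bigr => i _ do rewrite /bump /= add1n subSS binS mulrnDr.
rewrite big_split /= addrA [LHS]addrC; congr (_ + _).
rewrite [in RHS]big_ord_recl /= !bin0 !subn0; congr (_ + _).
rewrite big_ord_recr /= bin_small // mulr0n addr0; apply: eq_bigr => i _.
by rewrite /bump /= add1n subnSK.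
Qed.

(** By the Leibniz rule, coefficient [n.+1] of a product is a sum of coefficients [n] of products;
    associativity follows from the same induction. *)
Fact shuf_mulC : commutative shuf_mul.
Proof.
move=> f g; apply: shuffleP => n; elim: n f g => [|n IHn] f g.
  by rewrite !shuf_mul_at0 mulrC.
rewrite -!shiftE !shift_shuf_mul !shufD addrC.
by rewrite IHn [X in _ + X = _]IHn.
Qed.

Fact shuf_mulDl : left_distributive shuf_mul +%R.
Proof.
move=> f g h; apply: shuffleP => n /=; rewrite -big_split /=.
by apply: eq_bigr => i _; rewrite mulrDl mulrnDl.
Qed.

Fact shuf_mulA : associative shuf_mul.
Proof.
move=> f g h; apply: shuffleP => n; elim: n f g h => [|n IHn] f g h.
  by rewrite !shuf_mul_at0 mulrA.
rewrite -!shiftE !shift_shuf_mul shuf_mulDl.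
rewrite [shuf_mul f (_ + _)]shuf_mulC shuf_mulDl !shufD !IHn.
by rewrite -addrA ![shuf_mul _ f]shuf_mulC !IHn.
Qed.

Fact shuf_mul1l : left_id shuf_one shuf_mul.
Proof.
move=> f; apply: shuffleP => n /=; rewrite big_ord_recl /= bin0 subn0 mul1r.
by rewrite big1 ?addr0 // => i _; rewrite mul0r mul0rn.
Qed.

Fact shuf_one_neq0 : shuf_one != 0.
Proof.
by apply/eqP => /(congr1 (fun f : shuffle R => f 0%N)) /eqP; rewrite oner_eq0.
Qed.

HB.instance Definition _ := GRing.Zmodule_isComNzRing.Build (shuffle R)
  shuf_mulA shuf_mulC shuf_mul1l shuf_mulDl shuf_one_neq0.

Fact shuf_scaleAl (x : R) f g : x *: (f * g) = x *: f * g.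
Proof.
apply: shuffleP => n; rewrite shufZ /= mulr_sumr; apply: eq_bigr => i _.
by rewrite -mulrA mulrnAr.
Qed.

HB.instance Definition _ :=
  GRing.Lmodule_isLalgebra.Build R (shuffle R) shuf_scaleAl.
HB.instance Definition _ := GRing.Lalgebra_isComAlgebra.Build R (shuffle R).

Lemma shuf1 n : (1 : shuffle R) n = (n == 0%N)%:R. Proof. by []. Qed.

Lemma shufM f g n :
  (f * g) n = \sum_(i < n.+1) f i * g (n - i)%N *+ 'C(n, i).
Proof. by []. Qed.

Lemma shufM0 f g : (f * g) 0%N = f 0%N * g 0%N.
Proof. exact: shuf_mul_at0. Qed.

Lemma shiftM f g : shift (f * g) = shift f * g + f * shift g.
Proof. exact: shift_shuf_mul. Qed.

Lemma shift_is_linear : linear (@shift R : shuffle R -> shuffle R).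
Proof. by move=> x f g; apply: shuffleP. Qed.

HB.instance Definition _ :=
  GRing.isLinear.Build R (shuffle R) (shuffle R) *:%R (@shift R) shift_is_linear.

Definition const_term f : R := f 0%N.

Fact const_term_is_zmod_morphism : zmod_morphism const_term.
Proof. by []. Qed.
Fact const_term_is_monoid_morphism : monoid_morphism const_term.
Proof. by split=> // f g; rewrite /const_term shufM0. Qed.

HB.instance Definition _ := GRing.isZmodMorphism.Build (shuffle R) R
  const_term const_term_is_zmod_morphism.
HB.instance Definition _ := GRing.isMonoidMorphism.Build (shuffle R) R
  const_term const_term_is_monoid_morphism.

Lemma shufX0 f k : (f ^+ k) 0%N = f 0%N ^+ k.
Proof. exact: (rmorphXn const_term). Qed.

Lemma shift1 : shift (1 : shuffle R) = 0.
Proof. exact: shuffleP. Qed.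

Lemma shufMn f n k : (f *+ k) n = f n *+ k.
Proof. by elim: k => // k IHk; rewrite !mulrS shufD IHk. Qed.

Lemma shuf_sum (I : finType) (F : I -> shuffle R) n :
  (\sum_i F i) n = \sum_i F i n.
Proof.
by elim/big_rec2: _ => [|i y f _ <-] //; rewrite shufD.
Qed.

Lemma shiftX f k : shift (f ^+ k.+1) = shift f * f ^+ k *+ k.+1.
Proof.
elim: k => [|k IHk]; first by rewrite expr1 mulr1.
by rewrite exprS shiftM IHk mulrnAr mulrCA -exprS -mulrS.
Qed.

Lemma shuf_low f k n : f 0%N = 0 -> (n < k)%N -> (f ^+ k) n = 0.
Proof.
move=> f0; elim: k n => // k IHk n ltnk; rewrite exprS shufM.
rewrite big_ord_recl f0 mul0r mul0rn add0r big1 // => i _.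
by rewrite IHk ?mulr0 ?mul0rn //= /bump /=; move: (ltn_ord i); lia.
Qed.

Lemma shuf_diag f k : f 0%N = 0 -> (f ^+ k) k = f 1%N ^+ k *+ k`!.
Proof.
move=> f0; elim: k => [|k IHk]; first by rewrite shuf1 mulr1n.
rewrite -shiftE shiftX shufMn shufM big_ord_recl /= subn0 bin0 IHk.
rewrite big1 ?addr0 ?mulr1n => [|i _].
  by rewrite mulrnAr -exprS -mulrnA mulnC -factS.
by rewrite shuf_low ?mulr0 ?mul0rn //= /bump /=; move: (ltn_ord i); lia.
Qed.

Lemma shuf_eq_shift f g : f 0%N = g 0%N -> shift f = shift g -> f = g.
Proof.
move=> e0 es; apply: shuffleP => -[//|n].
by rewrite -!shiftE es.
Qed.

(** The equation determines coefficient [n.+1] from those up to [n]. Identities between exponentials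
    are reduced to this uniqueness. *)
Lemma shift_eq_unique (a : shuffle R) f g : f 0%N = g 0%N ->
  shift f = a * f -> shift g = a * g -> f = g.
Proof.
move=> e0 ef eg; apply: shuffleP; elim/ltn_ind=> -[//|n] IHn.
rewrite -!shiftE ef eg !shufM; apply: eq_bigr => i _.
by rewrite IHn // ltnS leq_subr.
Qed.

End ShuffleRing.

(** * The map exp_! and its differential equation *)

Definition to_shuf (R : Type) (C : series R) : shuffle R := Shuffle C.

Section Exponential.

Lemma exp_series_eq (R : comAlgType rat) (S S' : series R) n :
  (forall m, (m <= n)%N -> S m = S' m) -> exp_series S n = exp_series S' n.
Proof.
move=> eqS; apply: eq_bigr => -[k /= _] _; congr (_ *: _).
elim: k n eqS => [|k IHk] n eqS; first by rewrite !expr0.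
rewrite !exprS !scoefM; apply: eq_bigr => -[i /= ltin] _.
rewrite eqS // IHk // => m le_m; apply: eqS.
exact: leq_trans le_m (leq_subr _ _).
Qed.

Lemma exp_series_morph (R R' : comAlgType rat) (phi : {rmorphism R -> R'})
    (S : series R) n : (forall (x : rat) y, phi (x *: y) = x *: phi y) ->
  phi (exp_series S n) = exp_series (Series (fun m => phi (S m))) n.
Proof.
move=> phiZ; rewrite /= rmorph_sum; apply: eq_bigr => -[k /= _] _.
rewrite phiZ; congr (_ *: _).
elim: k n => [|k IHk] n; first by rewrite !expr0 !scoef1 rmorph_nat.
rewrite !exprS !scoefM rmorph_sum; apply: eq_bigr => i _.
by rewrite rmorphM IHk.
Qed.

Lemma mpoly_int_morph_eq n (S : comNzRingType)
    (F G : {rmorphism {mpoly int[n]} -> S}) :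
  (forall i, F 'X_i = G 'X_i) -> F =1 G.
Proof.
move=> eqX b; elim/mpolyind: b => [|c m b _ _ IHb]; first by rewrite !rmorph0.
rewrite !rmorphD IHb; congr (_ + _).
rewrite -[c]intz scaler_int !rmorphMz; congr (_ *~ _).
rewrite mpolyXE_id !rmorph_prod; apply: eq_bigr => i _.
by rewrite !rmorphXn eqX.
Qed.

(** Puts the polynomials [beta m], for all [m <= N], into one ring, where a recursion between them
    can be stated. *)
Definition beta_widen N m (lemN : (m <= N)%N) : {mpoly int[N]} :=
  mmap (@mpolyC N int) (fun i => 'X_(widen_ord lemN i)) (beta m).

Lemma beta_widen_eval (R : comNzRingType) N m (lemN : (m <= N)%N)
    (u : nat -> R) :
  mmap (intr : int -> R) (fun i : 'I_N => u i) (beta_widen lemN) =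
  mmap (intr : int -> R) (fun i : 'I_m => u i) (beta m).
Proof.
rewrite /beta_widen.
apply: (mpoly_int_morph_eq
  (F := mmap (intr : int -> R) (fun i : 'I_N => u i) \o
        mmap (@mpolyC N int) (fun i => 'X_(widen_ord lemN i)))
  (G := mmap (intr : int -> R) (fun i : 'I_m => u i))) => i /=.
by rewrite !mmapX !mmap1U mmapX mmap1U.
Qed.

Lemma beta_widen_rat N m (lemN : (m <= N)%N) :
  map_mpoly (intr : int -> rat) (beta_widen lemN) =
  exp_series (generic_egf N) m *+ m`!.
Proof.
pose phi : {rmorphism {mpoly rat[m]} -> {mpoly rat[N]}} :=
  mmap (@mpolyC N rat) (fun i : 'I_m => 'X_(widen_ord lemN i)).
have -> : map_mpoly intr (beta_widen lemN) = phi (beta_rat m).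
  rewrite -betaP /beta_widen.
  apply: (mpoly_int_morph_eq
    (F := map_mpoly (intr : int -> rat) \o
          mmap (@mpolyC N int) (fun i => 'X_(widen_ord lemN i)))
    (G := phi \o map_mpoly (intr : int -> rat))) => i /=.
  by rewrite mmapX mmap1U !map_mpolyX mmapX mmap1U.
rewrite /beta_rat mulr_natl rmorphMn; congr (_ *+ _).
have phiZ (x : rat) y : phi (x *: y) = x *: phi y.
  by rewrite /phi /= mmapZ mul_mpolyC.
have phiX i : phi 'X_i = 'X_(widen_ord lemN i) by rewrite /phi /= mmapX mmap1U.
move: (phi : {rmorphism _ -> _}) phiZ phiX => {}phi phiZ phiX.
rewrite (exp_series_morph _ _ phiZ).
(* The variables beyond the first [m] enter only in degrees above [m], so both generating series
   agree up to [m]. *)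
apply: exp_series_eq => l lelm /=; rewrite rmorph_sum /=.
case: l lelm => [|l] lelm; first by rewrite !big_pred0.
rewrite (big_pred1 (Ordinal lelm)) => [|i]; last by rewrite /= eqSS.
rewrite (big_pred1 (Ordinal (leq_trans lelm lemN))) => [|i]; last first.
  by rewrite /= eqSS.
rewrite phiZ phiX; congr (_ *: 'X_ _); exact: val_inj.
Qed.

Lemma exp_series_rec (R : comAlgType rat) (S : series R) n : S 0%N = 0 ->
  exp_series S n.+1 *+ n.+1`! =
  \sum_(i < n.+1) (S i.+1 *+ i.+1`!) *
    (exp_series S (n - i)%N *+ (n - i)`!) *+ 'C(n, i).
Proof.
move=> S0; rewrite factS mulrnA -derivpsE derivps_exp // scoefM -sumrMnl.
apply: eq_bigr => -[i /= ltin] _.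
move: (S _) => y; set x := \sum_(_ < _) _.
rewrite -(bin_fact (ltnSE ltin)) mulrnAl mulrnAr mulrnAl -!mulrnA.
by congr (_ *+ _); rewrite factS; lia.
Qed.

(** The differential equation E' = S'E of the exponential, read over the rationals, into which the
    integer polynomials embed. Being an integral identity, it can be evaluated in any commutative
    ring. *)
Lemma beta_widen_rec N n (ltnN : (n < N)%N) :
  beta_widen ltnN = \sum_(i < n.+1) 'X_(widen_ord ltnN i) *
    beta_widen (leq_trans (leq_subr i n) (ltnW ltnN)) *+ 'C(n, i).
Proof.
have inj : injective (map_mpoly (intr : int -> rat) : {mpoly int[N]} -> _).
  move=> b b' /mpolyP eqb; apply/mpolyP => m.
  by have := eqb m; rewrite !mcoeff_map_mpoly => /intr_inj.
apply: inj; rewrite beta_widen_rat exp_series_rec; last by rewrite /= big_pred0.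
rewrite rmorph_sum; apply: eq_bigr => i _ /=.
rewrite rmorphMn rmorphM /= beta_widen_rat map_mpolyX.
congr (_ * _ *+ _).
rewrite (big_pred1 (widen_ord ltnN i)) => [|l]; last by rewrite /= eqSS.
by rewrite -scaler_nat scalerA divff ?scale1r // pnatr_eq0 -lt0n fact_gt0.
Qed.

Variable R : comNzRingType.
Implicit Types A : series R.

Lemma exp_fact0 A : exp_fact A 0%N = 1.
Proof.
have b0 : beta 0 = 1.
  have inj : injective (map_mpoly (intr : int -> rat) : {mpoly int[0]} -> _).
    move=> b b' /mpolyP eqb; apply/mpolyP => m.
    by have := eqb m; rewrite !mcoeff_map_mpoly => /intr_inj.
  apply: inj; rewrite betaP /beta_rat mul1r /=.
  by rewrite big_ord_recl big_ord0 expr0 addr0 fact0 invr1 scale1r rmorph1.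
by rewrite /= b0 -mpolyC1 mmapC.
Qed.

Lemma shift_exp_fact A :
  shift (to_shuf (exp_fact A)) = shift (to_shuf A) * to_shuf (exp_fact A).
Proof.
apply: shuffleP => n; rewrite shiftE shufM.
transitivity (mmap (intr : int -> R) (fun i : 'I_n.+1 => A i.+1)
  (beta_widen (leqnn n.+1))).
  by rewrite (beta_widen_eval _ (fun i => A i.+1)).
rewrite beta_widen_rec rmorph_sum; apply: eq_bigr => i _.
rewrite rmorphMn rmorphM /= (beta_widen_eval _ (fun i => A i.+1)).
by rewrite mmapX mmap1U.
Qed.

End Exponential.

(** * Sections in characteristic p *)

Section Taylor.
Variable R : comNzRingType.
Implicit Types f g : shuffle R.

(** The Taylor expansion of [f] in divided powers of a new variable. Its multiplicativity encodes
    the Leibniz formulas of all orders. *)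
Definition taylor f : shuffle (shuffle R) := Shuffle (fun n => iter n (@shift R) f).

Lemma shift_taylor f : shift (taylor f) = taylor (shift f).
Proof. by apply: shuffleP => n; rewrite shiftE /= -iterS iterSr. Qed.

Lemma taylorM f g : taylor (f * g) = taylor f * taylor g.
Proof.
apply: shuffleP => n; elim: n f g => [|n IHn] f g; first by rewrite shufM0.
rewrite -!shiftE shiftM shufD !shift_taylor -!IHn shiftM.
by rewrite /=; elim: n {IHn} => //= n ->; rewrite shiftD.
Qed.

Lemma iter_shiftE f k n : iter k (@shift R) f n = f (n + k)%N.
Proof. by elim: k n => [|k IHk] n; rewrite ?addn0 //= IHk addSnnS. Qed.

End Taylor.

Section PrimeCharacteristic.
Variables (p : nat) (R : comNzRingType).
Hypothesis pR : p \in [pchar R].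

Let p_prime : prime p. Proof. by case/andP: pR. Qed.
Let p_gt0 : (0 < p)%N. Proof. exact: prime_gt0. Qed.

Lemma pchar_shuffle : p \in [pchar (shuffle R)].
Proof.
rewrite inE /= p_prime; apply/eqP/shuffleP => n.
by rewrite shufMn -mulr_natr pcharf0 // mulr0.
Qed.

(** The inner binomial coefficients ['C(p, i)] vanish in characteristic p. *)
Lemma shufM_at_p (f g : shuffle R) : (f * g) p = f 0%N * g p + f p * g 0%N.
Proof.
rewrite shufM (bigD1 ord0) //= (bigD1 ord_max) ?(gtn_eqF p_gt0) //=; last first.
  by rewrite -val_eqE /= (gtn_eqF p_gt0).
rewrite bin0 binn subn0 subnn !mulr1n addrA big1 ?addr0 //.
move=> i /andP[i0 ip]; rewrite -mulr_natr.
have /dvdnP[c ->] : (p %| 'C(p, i))%N.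
  rewrite prime_dvd_bin // lt0n [_ != _]i0 /= ltn_neqAle [_ != _]ip.
  by rewrite -ltnS ltn_ord.
by rewrite natrM (pcharf0 pR) !mulr0.
Qed.

(** Wilson's theorem; it allows the factor (p - 1)! to be cancelled. *)
Lemma mulrn_fact_pred (x : R) : x *+ (p.-1)`! = - x.
Proof.
apply/eqP; rewrite -addr_eq0 -mulrSr -mulr_natr.
have /dvdnP[c ->] : (p %| ((p.-1)`!).+1)%N.
  by rewrite -Wilson ?prime_gt1.
by rewrite natrM (pcharf0 pR) !mulr0.
Qed.

End PrimeCharacteristic.

Section Sections.
Variables (p : nat) (R : comNzRingType).
Hypothesis pR : p \in [pchar R].
Implicit Types f g : shuffle R.

Let p_prime : prime p. Proof. by case/andP: pR. Qed.
Let p_gt0 : (0 < p)%N. Proof. exact: prime_gt0. Qed.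
Let psR : p \in [pchar (shuffle R)]. Proof. exact: pchar_shuffle. Qed.

Lemma iter_shift_pM f g : iter p (@shift R) (f * g) =
  iter p (@shift R) f * g + f * iter p (@shift R) g.
Proof.
have := congr1 (fun F : shuffle _ => F p) (taylorM f g).
by rewrite (shufM_at_p psR) addrC.
Qed.

(* Jacobson's formula for the p-th power of the operator [shift + a]; the auxiliary
   [G] is (p - 1)! times the exponential of [F] truncated at order p, whose
   divided powers make sense in characteristic p. *)
Lemma iter_shift_exp (a f : shuffle R) : shift f = a * f ->
  iter p (@shift R) f = (iter p.-1 (@shift R) a + a ^+ p) * f.
Proof.
move=> df; have [m pE] : exists m, p = m.+1 by exists p.-1; rewrite prednK.
pose F : shuffle (shuffle R) :=
  Shuffle (fun n => if n is n'.+1 then iter n' (@shift R) a else 0).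
(* The falling factorial [v k] is m!/k!, with m = p - 1. *)
pose v k := (m ^_ (m - k))%N.
have vS k : (k < m)%N -> v k = (k.+1 * v k.+1)%N.
  move=> ltkm; rewrite /v -subnSK // ffactnSr mulnC; congr (_ * _)%N; lia.
pose G : shuffle (shuffle R) := \sum_(k < m.+1) F ^+ k *+ v k.
have F0 : F 0%N = 0 by [].
have dF : shift F = taylor a by exact: shuffleP.
have dG : shift G = taylor a * (G - F ^+ m).
  rewrite {2}/G big_ord_recr /= /v subnn ffactn0 mulr1n addrK.
  rewrite /G big_ord_recl raddfD /= raddfMn /= expr0 shift1 mul0rn add0r.
  rewrite raddf_sum mulr_sumr; apply: eq_bigr => -[k /= ltkm] _.
  rewrite /bump /= add1n raddfMn /= shiftX dF -mulrnA -mulrnAr.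
  by congr (_ * (_ *+ _)); rewrite -vS.
have G0 : G 0%N = (m`!)%:R.
  rewrite shuf_sum big_ord_recl big1 ?addr0 => [|k _].
    by rewrite shufMn expr0 /= /v subn0 ffactnn.
  by rewrite shufMn shufX0 F0 expr0n mul0rn.
have dT : shift (taylor f) = taylor a * taylor f.
  by rewrite shift_taylor df taylorM.
have TG n : (n <= m)%N -> taylor f n *+ m`! = f * G n.
  elim/ltn_ind: n => -[|n] IHn lenm; first by rewrite G0 mulr_natr.
  rewrite -!shiftE dT dG mulrDr shufD mulrDr mulrN shufN.
  rewrite [(_ * F ^+ m) n]big1 ?oppr0 ?mulr0 ?addr0 => [|i _].
    rewrite !shufM mulr_sumr -sumrMnl; apply: eq_bigr => i _.
    rewrite mulrnAr mulrCA -IHn ?ltnS ?leq_subr //; last first.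
      by apply: leq_trans (leq_subr _ _) (ltnW lenm).
    by rewrite mulrnAr -!mulrnA mulnC.
  by rewrite shuf_low ?mulr0 ?mul0rn //; lia.
(* At order p only the linear term of [G] survives: higher powers are products of two series without
   constant term, to which [shufM_at_p] applies. *)
have Gp : G p = iter m (@shift R) a *+ m`!.
  case: (posnP m) => [m0|m_gt0].
    by move: p_prime; rewrite pE m0.
  rewrite /G shuf_sum (bigD1 (Ordinal (m_gt0 : (1 < m.+1)%N))) //=.
  rewrite [X in _ + X]big1 ?addr0 => [|k nk1].
    rewrite expr1 shufMn pE; congr (_ *+ _).
    by have := vS _ m_gt0; rewrite mul1n /v subn0 ffactnn.
  rewrite shufMn; case: k nk1 => -[|[|k]] ltkm nk1.
  - by rewrite expr0 shuf1 pE mul0rn.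
  - by case/eqP: nk1; apply: val_inj.
  by rewrite exprS (shufM_at_p psR) F0 shufX0 F0 expr0n mulr0 mul0r addr0 mul0rn.
have : taylor f p *+ m`! = (iter m (@shift R) a + a ^+ p) * f *+ m`!.
  rewrite pE -shiftE dT.
  transitivity (f * (taylor a * G) m).
    rewrite !shufM mulr_sumr -sumrMnl; apply: eq_bigr => i _.
    rewrite mulrnAr mulrCA -TG ?leq_subr //.
    by rewrite mulrnAr -!mulrnA mulnC.
  (* The truncation defect [taylor a * F ^+ m] first contributes at order m, where it yields the
     term [a ^+ p]. *)
  have -> : taylor a * G = shift G + taylor a * F ^+ m.
    by rewrite dG -mulrDr subrK.
  rewrite shufD shiftE -pE Gp shufM big_ord_recl bin0 subn0 shuf_diag //.
  rewrite big1 ?addr0 => [|i _].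
    by rewrite mulr1n /= mulrnAr -exprS -pE -mulrnDl mulrnAr mulrC.
  by rewrite shuf_low ?mulr0 ?mul0rn //= /bump /=; move: (ltn_ord i); lia.
have -> : m = p.-1 by rewrite pE.
by rewrite !(mulrn_fact_pred psR) => /oppr_inj.
Qed.

Definition sect k f : shuffle R := Shuffle (fun n => f (k + n * p)%N).

Lemma sectE f k n : sect k f n = f (k + n * p)%N. Proof. by []. Qed.

Lemma sect_iter_shift f k l : sect l (iter k (@shift R) f) = sect (l + k) f.
Proof. by apply: shuffleP => n; rewrite !sectE iter_shiftE addnAC. Qed.

Lemma sect_shift f k : sect k (shift f) = sect k.+1 f.
Proof. by apply: shuffleP => n; rewrite !sectE shiftE. Qed.

Lemma shift_sect0 f : shift (sect 0 f) = sect 0 (iter p (@shift R) f).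
Proof.
by apply: shuffleP => n; rewrite sect_iter_shift shiftE !sectE mulSn.
Qed.

Lemma sect_is_linear k : linear (sect k).
Proof. by move=> x f g; apply: shuffleP. Qed.

HB.instance Definition _ k :=
  GRing.isLinear.Build R (shuffle R) (shuffle R) *:%R (sect k)
    (sect_is_linear k).

Lemma sectD f g k : sect k (f + g) = sect k f + sect k g.
Proof. exact: shuffleP. Qed.
Lemma sectZ x f k : sect k (x *: f) = x *: sect k f.
Proof. exact: shuffleP. Qed.

(** The p-fold shift is a derivation, and [sect 0] turns it into the shift; so both sides obey the
    same Leibniz recursion. *)
Lemma sect0M f g : sect 0 (f * g) = sect 0 f * sect 0 g.
Proof.
apply: shuffleP => n; elim: n f g => [|n IHn] f g.
  by rewrite shufM0 !sectE mul0n shufM0.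
rewrite -!shiftE shift_sect0 iter_shift_pM sectD shufD !IHn.
by rewrite shiftM !shift_sect0.
Qed.

(** The image under the morphism [sect 0] of coefficient k of [taylorM]. *)
Lemma sectM f g k : sect k (f * g) =
  \sum_(i < k.+1) sect i f * sect (k - i) g *+ 'C(k, i).
Proof.
rewrite -[k in LHS]add0n -sect_iter_shift.
have -> : iter k (@shift R) (f * g) = (taylor f * taylor g) k by rewrite -taylorM.
rewrite shufM (raddf_sum (sect 0%N)); apply: eq_bigr => i _.
rewrite (raddfMn (sect 0%N)); congr (_ *+ _).
by rewrite /= sect0M !sect_iter_shift !add0n.
Qed.

Lemma sect1 k : sect k 1 = (k == 0%N)%:R.
Proof.
apply: shuffleP => n; rewrite sectE shuf1 addn_eq0 muln_eq0 (gtn_eqF p_gt0) orbF.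
by case: k.
Qed.

(** The derivative of a p-th power carries a factor p, so [f ^+ p] is constant. *)
Lemma shuf_expp f : f ^+ p = f 0%N ^+ p *: 1.
Proof.
apply: shuf_eq_shift; first by rewrite shufX0 shufZ shuf1 mulr1.
have [m pE] : exists m, p = m.+1 by exists p.-1; rewrite prednK.
rewrite [RHS]linearZ /= shift1 scaler0 {1}pE shiftX -pE -mulr_natr.
by rewrite (pcharf0 psR) mulr0.
Qed.

Definition svar : shuffle R := Shuffle (fun n => (n == 1%N)%:R).

Lemma shift_svar : shift svar = 1.
Proof. by apply: shuffleP => n; rewrite shiftE /= eqSS. Qed.

Lemma sect_svar k : sect k svar = (k == 1%N)%:R.
Proof.
case: k => [|k]; last by rewrite -sect_shift shift_svar sect1.
apply: shuffleP => n; rewrite sectE /= add0n muln_eq1.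
by rewrite (gtn_eqF (prime_gt1 p_prime)) andbF.
Qed.

Definition sexp f : shuffle R := to_shuf (exp_fact (Series f)).

Lemma sexp0 f : sexp f 0%N = 1. Proof. exact: exp_fact0. Qed.

Lemma shift_sexp f : shift (sexp f) = shift f * sexp f.
Proof. by rewrite shift_exp_fact; congr (_ * _); apply: shuffleP. Qed.

(** Jacobson's formula for [shift a], followed by [sect 0]; the p-th power of [shift a] is a
    constant by [shuf_expp]. *)
Lemma shift_sect_exp (a f : shuffle R) : shift f = shift a * f ->
  shift (sect 0 f) = (shift (sect 0 a) + a 1%N ^+ p *: 1) * sect 0 f.
Proof.
move=> df; rewrite !shift_sect0 (iter_shift_exp df) sect0M sectD; congr (_ * _).
by rewrite -iterSr prednK // shuf_expp shiftE sectZ sect1.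
Qed.

Lemma sect_sexp f :
  sect 0 (sexp f) = sexp (sect 0 f + f 1%N ^+ p *: svar).
Proof.
apply: (shift_eq_unique (a := shift (sect 0 f) + f 1%N ^+ p *: 1)).
- by rewrite sectE !sexp0.
- exact/shift_sect_exp/shift_sexp.
- by rewrite shift_sexp raddfD /= linearZ /= shift_svar.
Qed.

End Sections.

(** * Finite spans and dimensions *)

Section FiniteSpans.
Variables (K : fieldType) (V : lmodType K).
Implicit Types (I J : finType) (S W : set V).

(** Any finite index type is allowed, so that dimension bounds come out as cardinals of sum, product
    and function types. *)
Definition lspan I (u : I -> V) : set V :=
  [set v | exists c : I -> K, v = \sum_i c i *: u i].

Lemma lspan0 I (u : I -> V) : lspan u 0.
Proof. by exists (fun=> 0); rewrite big1 // => i _; rewrite scale0r. Qed.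

Lemma lspanD I (u : I -> V) v w : lspan u v -> lspan u w -> lspan u (v + w).
Proof.
move=> [c ->] [d ->]; exists (fun i => c i + d i).
by rewrite -big_split; apply: eq_bigr => i _; rewrite scalerDl.
Qed.

Lemma lspanZ I (u : I -> V) x v : lspan u v -> lspan u (x *: v).
Proof.
move=> [c ->]; exists (fun i => x * c i).
by rewrite scaler_sumr; apply: eq_bigr => i _; rewrite scalerA.
Qed.

Lemma lspanMn I (u : I -> V) v n : lspan u v -> lspan u (v *+ n).
Proof. by move=> uv; rewrite -scaler_nat; apply: lspanZ. Qed.

Lemma lspan_sum I (u : I -> V) J (w : J -> V) :
  (forall j, lspan u (w j)) -> lspan u (\sum_j w j).
Proof. by move=> uw; elim/big_ind: _ => //; [exact: lspan0|exact: lspanD]. Qed.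

Lemma lspan_id I (u : I -> V) i : lspan u (u i).
Proof.
exists (fun j => (j == i)%:R); rewrite (bigD1 i) //= eqxx scale1r big1 ?addr0 //.
by move=> j /negPf ->; rewrite scale0r.
Qed.

Lemma lspan_sub I J (u : I -> V) (w : J -> V) :
  (forall i, lspan w (u i)) -> forall v, lspan u v -> lspan w v.
Proof.
by move=> wu v [c ->]; apply: lspan_sum => i; apply: lspanZ.
Qed.

Lemma span_set_sub S (W : set V) : W 0 ->
  (forall v w, W v -> W w -> W (v + w)) -> (forall x v, W v -> W (x *: v)) ->
  (forall v, S v -> W v) -> forall v, span_set S v -> W v.
Proof.
move=> W0 WD WZ SW v [n [c [s [Ss ->]]]].
by elim/big_ind: _ => // i _; apply/WZ/SW.
Qed.

Lemma span_set_id S v : S v -> span_set S v.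
Proof.
by move=> Sv; exists 1%N, (fun=> 1), (fun=> v); rewrite big_ord1 scale1r.
Qed.

Lemma span_set_sum S n (c : 'I_n -> K) (s : 'I_n -> V) :
  (forall i, span_set S (s i)) -> span_set S (\sum_i c i *: s i).
Proof.
move=> Ss; elim/big_ind: _ => [|v w|i _].
- exists 0%N, (fun=> 0), (fun=> 0); split; last by rewrite big_ord0.
  by case.
- move=> [n1 [c1 [s1 [S1 ->]]]] [n2 [c2 [s2 [S2 ->]]]].
  pose F (T : Type) (f1 : 'I_n1 -> T) (f2 : 'I_n2 -> T) i :=
    match split i with inl j => f1 j | inr j => f2 j end.
  exists (n1 + n2)%N, (F _ c1 c2), (F _ s1 s2).
  split=> [i|]; first by rewrite /F; case: (split i).
  rewrite big_split_ord; congr (_ + _); apply: eq_bigr => i _.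
    by rewrite /F (unsplitK (inl i)).
  by rewrite /F (unsplitK (inr i)).
- case: (Ss i) => n1 [c1 [s1 [S1 ->]]].
  exists n1, (fun j => c i * c1 j), s1; split=> //.
  by rewrite scaler_sumr; apply: eq_bigr => j _; rewrite scalerA.
Qed.

Lemma span_set_range n (b : 'I_n -> V) : span_set (range b) = lspan b.
Proof.
apply/seteqP; split => [|v [c ->]].
  apply: span_set_sub; [exact: lspan0|exact: lspanD|exact: lspanZ|].
  by move=> _ [i _ <-]; apply: lspan_id.
by exists n, c, b; split=> // i; exists i.
Qed.

(** A coefficient matrix with more rows than columns has a non-zero left kernel vector, which is a
    linear relation. *)
Lemma lin_indep_leq n (b : 'I_n -> V) I (u : I -> V) :
  lin_indep b -> (forall i, lspan u (b i)) -> (n <= #|I|)%N.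
Proof.
move=> b_free ub; rewrite leqNgt; apply/negP => ltIn.
have [c cE] : exists c : 'I_n -> I -> K, forall i, b i = \sum_j c i j *: u j.
  by have [c cE] := choice ub; exists c.
pose M : 'M[K]_(n, #|I|) := \matrix_(i, j) c i (enum_val j).
have : kermx M != 0.
  rewrite -mxrank_eq0 mxrank_ker subn_eq0 -ltnNge.
  exact: leq_ltn_trans (rank_leq_col _) ltIn.
case/rowV0Pn => v /sub_kermxP vM0 /eqP[]; apply/rowP => i; rewrite mxE.
apply: (b_free (fun i => v 0 i)) i.
transitivity (\sum_j (\sum_i v 0 i * c i j) *: u j).
  under eq_bigr => i _ do rewrite cE scaler_sumr.
  rewrite exchange_big; apply: eq_bigr => j _; rewrite scaler_suml.
  by apply: eq_bigr => i _; rewrite scalerA.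
rewrite big1 // => j _; have /rowP/(_ (enum_rank j)) := vM0.
rewrite !mxE => vM; have -> : \sum_i v 0 i * c i j = 0.
  by rewrite -[RHS]vM; apply: eq_bigr => i _; rewrite mxE enum_rankK.
by rewrite scale0r.
Qed.

End FiniteSpans.

Section Dimensions.
Variable K : fieldType.

Lemma lin_indep_linear (V V' : lmodType K) (f : {linear V -> V'}) n
  (b : 'I_n -> V) : injective f -> lin_indep b -> lin_indep (f \o b).
Proof.
move=> f_inj b_free c /= cfb; apply: b_free; apply: f_inj.
by rewrite linear0 linear_sum -[RHS]cfb; apply: eq_bigr => i _; rewrite linearZ.
Qed.

Lemma lin_indep_extend (V : lmodType K) n (b : 'I_n -> V) v : lin_indep b ->
  ~ lspan b v -> lin_indep (fun i => oapp b v (unlift ord0 i)).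
Proof.
move=> b_free bv c; rewrite big_ord_recl unlift_none /=.
under eq_bigr => i _ do rewrite liftK /=.
have [c0 | c0] := eqVneq (c ord0) 0.
  rewrite c0 scale0r add0r => /(b_free (fun i => c (lift ord0 i))) c0' i.
  by case: (unliftP ord0 i) => [j ->|->]; [exact: c0'|].
move=> /(canRL (addrK _)); rewrite sub0r => cv; case: bv.
exists (fun i => - (c ord0)^-1 * c (lift ord0 i)).
rewrite -[v](scalerK c0) cv scalerN scaler_sumr -sumrN; apply: eq_bigr => i _.
by rewrite scalerA mulNr scaleNr.
Qed.

(** A maximal independent family inside [S] is a basis of its span. The injection [f] lets the
    bounding family live elsewhere, as after multiplication by a denominator. *)
Lemma span_has_dim (V V' : lmodType K) (f : {linear V -> V'}) (S : set V)
    (I : finType) (u : I -> V') : injective f ->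
  (forall v, S v -> lspan u (f v)) ->
  exists2 n, (n <= #|I|)%N & has_dim (span_set S) n.
Proof.
move=> f_inj fS.
pose P n := `[< exists2 b : 'I_n -> V, lin_indep b & forall i, S (b i) >].
have P0 : exists n, P n.
  exists 0%N; apply/asboolP.
  by exists (fun=> 0) => [c _ []|[]].
have Pn n : P n -> (n <= #|I|)%N.
  move=> /asboolP[b b_free bS].
  exact: (lin_indep_leq (lin_indep_linear f_inj b_free) (fun i => fS _ (bS i))).
case: (ex_maxnP P0 Pn) => n Pnn n_max; exists n; first exact: Pn.
case/asboolP: (Pnn) => b b_free bS; exists b => //; rewrite span_set_range.
apply/seteqP; split => [|_ [c ->]]; last first.
  by apply: span_set_sum => i; apply: span_set_id.
apply: span_set_sub; [exact: lspan0|exact: lspanD|exact: lspanZ|].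
move=> v Sv; apply: contrapT => bv.
have : (n.+1 <= n)%N by [
  apply: n_max; apply/asboolP; exists (fun i => oapp b v (unlift ord0 i));
  [exact: lin_indep_extend|move=> i; case: unlift => //=]].
by rewrite ltnn.
Qed.

Lemma has_dim_leq (V : lmodType K) (W : set V) n (I : finType) (u : I -> V) :
  has_dim W n -> (forall v, W v -> lspan u v) -> (n <= #|I|)%N.
Proof.
move=> [b b_free WE] Wu; apply: lin_indep_leq b_free _ => i.
by apply: Wu; rewrite WE span_set_range; apply: lspan_id.
Qed.

Lemma has_dim_dimension (V : lmodType K) (W : set V) :
  fin_dim W -> has_dim W (dimension W).
Proof. by move=> [n Wn]; apply: (xgetI _ Wn). Qed.

Lemma dimension_leq (V : lmodType K) (S : set V) (I : finType) (u : I -> V) :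
  (forall v, S v -> lspan u v) ->
  fin_dim (span_set S) /\ (dimension (span_set S) <= #|I|)%N.
Proof.
move=> Su; have [n leI dimn] := span_has_dim (f := idfun) (fun _ _ => id) Su.
have fdS : fin_dim (span_set S) by exists n.
split=> //; apply: has_dim_leq (has_dim_dimension fdS) _ => v.
by apply: span_set_sub; [exact: lspan0|exact: lspanD|exact: lspanZ|exact: Su].
Qed.

End Dimensions.

(** * Determining elements of a finite span by finitely many coefficients *)

Section Evaluation.
Variable K : fieldType.
Implicit Types v w : shuffle K.

(** Pivot elimination: subtracting multiples of some [u j] with [u j x != 0] makes the other
    generators vanish at [x]. *)
Lemma lspan_vanish n (u : 'I_n.+1 -> shuffle K) x w :
  lspan u w -> w x != 0 ->
  exists u' : 'I_n -> shuffle K, forall v, lspan u v -> v x = 0 -> lspan u' v.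
Proof.
move=> uw xw0; have [j xj0] : exists j, u j x != 0.
  case: uw xw0 => c ->; rewrite shuf_sum => s0.
  apply: contrapT => /forallNP nj; case/eqP: s0; rewrite big1 // => i _.
  by rewrite shufZ; have /negP := nj i; rewrite negbK => /eqP ->; rewrite mulr0.
exists (fun i => u (lift j i) - (u (lift j i) x / u j x) *: u j).
move=> v [c ->] xv0; exists (fun i => c (lift j i)).
pose d := \sum_i c (lift j i) * (u (lift j i) x / u j x).
have cj : c j = - d.
  apply: (mulIf xj0); rewrite mulNr mulr_suml; apply/eqP; rewrite -addr_eq0.
  rewrite -[X in _ == X]xv0 shuf_sum (bigD1_ord j) //=; apply/eqP.
  congr (_ + _); apply: eq_bigr => i _.
  by rewrite -mulrA divfK.
rewrite (bigD1_ord j) //= cj scaleNr addrC scaler_suml -sumrB.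
by apply: eq_bigr => i _; rewrite scalerBr scalerA.
Qed.

(** Each coefficient that is not identically zero on the span lowers the number of generators by
    one. This bounds the number of elements with coefficients in a finite field. *)
Lemma lspan_coordinates n (u : 'I_n -> shuffle K) :
  exists x : 'I_n -> nat,
    forall v, lspan u v -> (forall i, v (x i) = 0) -> v = 0.
Proof.
elim: n u => [|n IHn] u.
  by exists (fun=> 0%N) => v [c ->] _; rewrite big_ord0.
have [[x [w [uw xw0]]]|nux] :=
    pselect (exists x w, lspan u w /\ w x != 0); last first.
  exists (fun=> 0%N) => v uv _; apply: shuffleP => x; apply/eqP.
  by apply: contrapT => /negP xv0; apply: nux; exists x, v.
have [u' u'P] := lspan_vanish uw xw0; have [y yP] := IHn u'.
exists (fun i => oapp y x (unlift ord0 i)) => v uv v0.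
apply: yP => [|i]; last by have := v0 (lift ord0 i); rewrite liftK.
by apply: u'P => //; have := v0 ord0; rewrite unlift_none.
Qed.

End Evaluation.

(** * The p-kernel and stability under sections *)

Section KernelStability.
Variables (p : nat) (K : fieldType).
Hypothesis p_gt0 : (0 < p)%N.

Lemma pkernel_sub (S : set (series K)) C : S C ->
  (forall D k, (k < p)%N -> S D -> S (section p D k 1)) ->
  forall D, (D = C \/ exists f k, [/\ (1 <= f)%N, (k < p ^ f)%N &
     D = section p C k f]) -> S D.
Proof.
move=> SC Ssec D [-> //|[f [k [_ ltk ->]]]] {D}.
elim: f k C SC ltk => [|f IHf] k C SC ltk.
  have -> : section p C k 0 = C; last by [].
  apply: seriesP => n /=; rewrite expn0 ltnS leqn0 in ltk *.
  by rewrite (eqP ltk) muln1.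
(* Splitting off the lowest base-p digit of [k] makes every section an iterate of sections of order
   one. *)
have -> : section p C k f.+1 = section p (section p C (k %% p) 1) (k %/ p) f.
  apply: seriesP => n /=; congr (C _).
  by rewrite expn1 [in LHS](divn_eq k p) expnS; lia.
apply: IHf; first by apply: Ssec => //; rewrite ltn_mod.
by rewrite ltn_divLR // mulnC -expnS.
Qed.

Definition of_shuf (f : shuffle K) : series K := Series f.

Fact to_shuf_is_linear : linear (@to_shuf K : series K -> shuffle K).
Proof. by move=> x C D; apply: shuffleP. Qed.
Fact of_shuf_is_linear : linear of_shuf.
Proof. by move=> x f g; apply: seriesP. Qed.

HB.instance Definition _ := GRing.isLinear.Build K (series K) (shuffle K)
  *:%R (@to_shuf K) to_shuf_is_linear.
HB.instance Definition _ := GRing.isLinear.Build K (shuffle K) (series K)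
  *:%R of_shuf of_shuf_is_linear.

Lemma to_shufK : cancel (@to_shuf K) of_shuf.
Proof. by case. Qed.
Lemma of_shufK : cancel of_shuf (@to_shuf K).
Proof. by case. Qed.

Lemma to_shuf_section (C : series K) k :
  to_shuf (section p C k 1) = sect p k (to_shuf C).
Proof. by apply: shuffleP => n; rewrite /= expn1. Qed.

Lemma pkernel_section (C D : series K) k : (k < p)%N -> pkernel p C D ->
  pkernel p C (section p D k 1).
Proof.
move=> ltkp [n [c [s [Cs ->]]]].
have -> : section p (\sum_i c i *: s i) k 1 =
          \sum_i c i *: section p (s i) k 1.
  apply: (can_inj to_shufK); rewrite to_shuf_section !linear_sum.
  by apply: eq_bigr => i _; rewrite !linearZ /= to_shuf_section.
apply: span_set_sum => i; apply: span_set_id.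
case: (Cs i) => [->|[f [l [f_gt0 ltl ->]]]]; right.
  by exists 1%N, k; rewrite expn1.
exists f.+1, (l + k * p ^ f)%N; split=> //.
  rewrite expnS; move: (p ^ f)%N ltl => pf ltl.
  by apply: (@leq_trans (pf + k * pf)); rewrite ?ltn_add2r // -mulSn leq_mul.
by apply: seriesP => m /=; congr (C _); rewrite expn1 expnS; lia.
Qed.

Lemma pkernel_shuffle (C : series K) n : has_dim (pkernel p C) n ->
  exists u : 'I_n -> shuffle K, lspan u (to_shuf C) /\
    forall k f, (k < p)%N -> lspan u f -> lspan u (sect p k f).
Proof.
move=> [b _ bE]; exists (@to_shuf K \o b).
have toE D : pkernel p C D -> lspan (@to_shuf K \o b) (to_shuf D).
  rewrite bE span_set_range => -[c ->]; exists c; rewrite linear_sum.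
  by apply: eq_bigr => i _; rewrite linearZ.
split; first by apply/toE/span_set_id; left.
move=> k f ltkp [c fE]; rewrite -(of_shufK f) -to_shuf_section.
apply/toE/pkernel_section => //; rewrite bE span_set_range fE linear_sum.
by exists c; apply: eq_bigr => i _; rewrite linearZ /= to_shufK.
Qed.

(** The criterion behind every bound on [kappa]. [S] is any set closed under sections, such as a
    union or a family of products. *)
Lemma kappa_leq (C : series K) (S : set (shuffle K)) (I : finType)
    (w : I -> shuffle K) : S (to_shuf C) ->
    (forall k f, (k < p)%N -> S f -> S (sect p k f)) ->
    (forall f, S f -> lspan w f) ->
  fin_dim (pkernel p C) /\ (kappa p C <= #|I|)%N.
Proof.
move=> SC Ssec Sw; apply: (dimension_leq (u := of_shuf \o w)) => D DC.
have : S (to_shuf D).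
  apply: (pkernel_sub (S := fun E => S (to_shuf E))) DC => // E k ltkp SE.
  by rewrite to_shuf_section; apply: Ssec.
move=> /Sw[c DE]; exists c; rewrite -(to_shufK D) DE linear_sum.
by apply: eq_bigr => i _; rewrite linearZ.
Qed.

End KernelStability.

(** * The exponential *)

Section ExpBound.
Variables (p : nat) (K : fieldType).
Hypothesis pK : p \in [pchar K].
Variables (n : nat) (u : 'I_n -> shuffle K).
Hypothesis u_sect :
  forall k f, (k < p)%N -> lspan u f -> lspan u (sect p k f).

Let p_prime : prime p. Proof. by case/andP: pK. Qed.
Let p_gt0 : (0 < p)%N. Proof. exact: prime_gt0. Qed.

(** Removing the constant terms makes the p-th powers of the generators vanish. *)
Let b i : shuffle K := u i - u i 0%N *: 1.

Let b_expp i k : (p <= k)%N -> b i ^+ k = 0.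
Proof.
move=> lepk; rewrite -(subnKC lepk) exprD (shuf_expp pK).
by rewrite shufD shufN shufZ shuf1 mulr1 subrr expr0n (gtn_eqF p_gt0) scale0r mul0r.
Qed.

(** Exponents below p suffice by nilpotency, hence [p ^ n] monomials. *)
Definition shuf_mono (e : {ffun 'I_n -> 'I_p}) : shuffle K :=
  \prod_i b i ^+ e i.

Let alg := lspan shuf_mono.

Let alg_b_exp (e : 'I_n -> nat) : alg (\prod_i b i ^+ e i).
Proof.
have [ltep|/existsNP[i /negP]] := pselect (forall i, (e i < p)%N).
  have := lspan_id shuf_mono [ffun i => Ordinal (ltep i)].
  by rewrite /shuf_mono; under eq_bigr do rewrite ffunE.
rewrite -leqNgt => lepi.
by rewrite (bigD1 i) //= b_expp // mul0r; apply: lspan0.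
Qed.

Let alg1 : alg 1.
Proof. by have := alg_b_exp (fun=> 0%N); rewrite big1. Qed.

Let algM P Q : alg P -> alg Q -> alg (P * Q).
Proof.
move=> [c ->] [d ->]; rewrite mulr_suml; apply: lspan_sum => i.
rewrite mulr_sumr; apply: lspan_sum => j; rewrite -scalerAl -scalerAr.
apply/lspanZ/lspanZ; rewrite /shuf_mono -big_split /=.
by under eq_bigr do rewrite -exprD; apply: alg_b_exp.
Qed.

Let alg_u f : lspan u f -> alg f.
Proof.
apply: lspan_sub => i; rewrite -[u i](subrK (u i 0%N *: 1)).
apply: lspanD; last exact: lspanZ.
have := alg_b_exp (fun l => (l == i) : nat).
rewrite (bigD1 i) //= eqxx expr1 big1 ?mulr1 // => l /negPf ->.
by rewrite expr0.
Qed.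

Let alg_sect k f : (k < p)%N -> alg f -> alg (sect p k f).
Proof.
pose Q g := forall l, (l < p)%N -> alg (sect p l g).
have Q1 : Q 1.
  move=> l _; rewrite (sect1 pK); case: eqP => _; [exact: alg1|exact: lspan0].
have QM g h : Q g -> Q h -> Q (g * h).
  move=> Qg Qh l ltlp; rewrite (sectM pK); apply: lspan_sum => i.
  apply: lspanMn; apply: algM; [apply: Qg|apply: Qh]; move: (ltn_ord i); lia.
suff Qmono e : Q (shuf_mono e).
  move=> ltkp [c ->]; rewrite (raddf_sum (sect p k)); apply: lspan_sum => e.
  by rewrite /= sectZ; apply/lspanZ/Qmono.
have Qb i : Q (b i).
  move=> l ltlp; rewrite (raddfB (sect p l)) /= sectZ; apply: lspanD.
    by apply/alg_u/u_sect => //; apply: lspan_id.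
  by rewrite -scaleNr; apply/lspanZ/Q1.
rewrite /shuf_mono; elim/big_ind: _ => // i _.
by elim: {e}(nat_of_ord _) => // l IHl; rewrite exprS; apply: QM.
Qed.

(** For E = [sexp B], the section of index [k.+1] of E is that of index k of B'E; [sectM] expresses
    it through sections of E of smaller index. *)
Let alg_sect_sexp B : (forall k, (0 < k < p)%N -> alg (sect p k B)) ->
  forall k, (k < p)%N -> exists2 Q, alg Q &
    sect p k (sexp B) = Q * sect p 0 (sexp B).
Proof.
move=> Balg; elim/ltn_ind => -[_ _|k IHk ltkp].
  by exists 1 => //; rewrite mul1r.
rewrite -sect_shift shift_sexp (sectM pK); set E := sexp B.
elim/big_ind: _ => [|f g [P algP ->] [Q algQ ->]|i _].
- by exists 0; [exact: lspan0|rewrite mul0r].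
- by exists (P + Q); [exact: lspanD|rewrite mulrDl].
have [||Q algQ ->] := IHk (k - i)%N; [lia|lia|].
exists (sect p i (shift B) * Q *+ 'C(k, i)).
  apply/lspanMn/algM => //; rewrite sect_shift; apply: Balg.
  by move: (ltn_ord i); lia.
by rewrite mulrnAl mulrA.
Qed.

Variables (Fq : finFieldType) (j : {rmorphism Fq -> K}).
Variable A : series K.
Hypotheses (A0 : A 0%N = 0) (A_neq0 : A != 0).
Hypothesis A_coef : forall n, exists a : Fq, A n = j a.
Hypothesis u_A : lspan u (to_shuf A).

(** Sections along the base-p digits of [l] move a non-zero coefficient of [A] at index [l] to index
    0. *)
Let exists_const : exists2 f, lspan u f & f 0%N != 0.
Proof.
have [l Al] : exists l, A l != 0.
  apply: contrapT => /forallNP A00; case/eqP: A_neq0; apply: seriesP => l.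
  by apply/eqP/negPn/negP/A00.
suff : forall f, lspan u f -> f l != 0 -> exists2 f, lspan u f & f 0%N != 0.
  by move=> ex; apply: ex u_A Al.
elim/ltn_ind: l {Al} => -[_ f uf fl|l IHl f uf fl]; first by exists f.
apply: (IHl (l.+1 %/ p)%N _ (sect p (l.+1 %% p)%N f)).
- by rewrite ltn_Pdiv // prime_gt1.
- by apply: u_sect; rewrite // ltn_mod.
- by rewrite sectE addnC -divn_eq.
Qed.

Lemma kappa_exp_fact :
  fin_dim (pkernel p (exp_fact A)) /\
  (0 < n /\ kappa p (exp_fact A) <= p ^ n * (#|Fq| ^ n.-1 * #|Fq|))%N.
Proof.
have [f0 uf0 f00] := exists_const.
have [m nE] : exists m, n = m.+1.
  case: n u uf0 => [|m]; last by exists m.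
  by move=> u0 [c f0E]; move: f00; rewrite f0E big_ord0 eqxx.
(* The elements without constant term need one generator fewer; this is the origin of the exponent
   [n.-1]. *)
have [u' u'P] : exists u' : 'I_m -> shuffle K,
    forall v, lspan u v -> v 0%N = 0 -> lspan u' v.
  by case: _ / (esym nE) u uf0 => u1 u1f0; apply: lspan_vanish u1f0 f00.
have [x xP] := lspan_coordinates u'.
(* The element with coordinates [y], unique by [xP], or the default 0 if there is none. *)
pose G (y : {ffun 'I_m -> Fq}) : shuffle K :=
  xget 0 [set g | lspan u' g /\ forall i, g (x i) = j (y i)].
pose w (r : {ffun 'I_n -> 'I_p} * ({ffun 'I_m -> Fq} * Fq)) : shuffle K :=
  shuf_mono r.1 * sexp (G r.2.1 + j r.2.2 *: svar K).
pose S : set (shuffle K) := fun f => exists P g t, [/\ alg P, lspan u g,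
  g 0%N = 0, forall l, exists a, g l = j a &
  f = P * sexp (g + j t *: svar K)].
have SA : S (to_shuf (exp_fact A)).
  exists 1, (to_shuf A), 0; split=> //.
  rewrite mul1r rmorph0 scale0r addr0 /sexp; congr (to_shuf (exp_fact _)).
  exact: seriesP.
have Ssect k f : (k < p)%N -> S f -> S (sect p k f).
  move=> ltkp [P [g [t [algP ug g0 gj ->]]]].
  pose B := g + j t *: svar K.
  have Balg l : (0 < l < p)%N -> alg (sect p l B).
    move=> /andP[_ ltlp]; rewrite sectD sectZ (sect_svar pK); apply: lspanD.
      exact/alg_u/u_sect.
    by apply: lspanZ; case: eqP => _; [exact: alg1|exact: lspan0].
  have [a ga] := gj 1%N.
  have [Q algQ ->] : exists2 Q, alg Q &
      sect p k (P * sexp B) = Q * sect p 0 (sexp B).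
    rewrite (sectM pK).
    elim/big_ind: _ => [|f1 f2 [P1 algP1 ->] [P2 algP2 ->]|i _].
    - by exists 0; [exact: lspan0|rewrite mul0r].
    - by exists (P1 + P2); [exact: lspanD|rewrite mulrDl].
    have [|Q algQ ->] := @alg_sect_sexp B Balg (k - i)%N; first by lia.
    exists (sect p i P * Q *+ 'C(k, i)); last by rewrite mulrnAl mulrA.
    apply/lspanMn/algM => //; apply: alg_sect => //.
    by move: (ltn_ord i); lia.
  (* The coefficient of [B] at index 1 is the image of [a + t], and [sect 0] kills [svar]; so
     [sect_sexp] produces this new parameter. *)
  exists Q, (sect p 0 g), ((a + t) ^+ p); split=> //.
  - exact: u_sect.
  - by move=> l; rewrite sectE; apply: gj.
  congr (_ * _); rewrite (sect_sexp pK) sectD sectZ (sect_svar pK) /=.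
  by rewrite scaler0 addr0 rmorphXn rmorphD /= ?shufD /= mulr1 ga.
have Sw f : S f -> lspan w f.
  move=> [P [g [t [[c ->] ug g0 gj ->]]]].
  have [y yP] := choice gj; pose y' := [ffun i => y (x i)].
  have [u'G GE] : lspan u' (G y') /\ forall i, G y' (x i) = j (y' i).
    apply: (@xgetI _ 0 [set g | lspan u' g /\ forall i, g (x i) = j (y' i)] g).
    by split=> [|i]; [exact: u'P|rewrite ffunE].
  have -> : g = G y'.
    apply/eqP; rewrite -subr_eq0; apply/eqP; apply: xP => [|i].
      by rewrite -scaleN1r; apply: lspanD; [exact: u'P|exact: lspanZ].
    by rewrite shufD shufN GE ffunE yP subrr.
  rewrite mulr_suml; apply: lspan_sum => e; rewrite -scalerAl; apply: lspanZ.
  exact: (lspan_id w (e, (y', t))).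
have [fd le] := kappa_leq p_gt0 SA Ssect Sw; split=> //.
split; first by rewrite nE.
by move: le; rewrite !card_prod !card_ffun !card_ord {3}nE.
Qed.

End ExpBound.

(** After cancelling [q ^ n.-1], it remains to compare exponents of p: n + e <= e n + 1 <= p^(e
    n). *)
Lemma exp_bound_leq p e q n : prime p -> q = (p ^ e)%N -> (0 < e)%N ->
  (0 < n)%N -> (p ^ n * (q ^ n.-1 * q) <= q ^ (n - 1) * p ^ (q ^ n))%N.
Proof.
move=> p_prime -> e_gt0; case: n => // n _.
rewrite subn1 /= mulnC -mulnA leq_mul2l -expnD leq_exp2l ?prime_gt1 //.
apply/orP; right; rewrite -expnM.
apply: (@leq_trans (e * n.+1).+1); first by nia.
by apply: ltn_expl; apply: prime_gt1.
Qed.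

(** * The logarithm *)

Section Integral.
Variable R : comNzRingType.

Definition integ (f : shuffle R) : shuffle R :=
  Shuffle (fun n => if n is n'.+1 then f n' else 0).

Fact integ_is_linear : linear integ.
Proof.
by move=> x f g; apply: shuffleP => -[|n] //=; rewrite mulr0 addr0.
Qed.

HB.instance Definition _ := GRing.isLinear.Build R (shuffle R) (shuffle R)
  *:%R integ integ_is_linear.

Lemma shift_integ f : shift (integ f) = f.
Proof. exact: shuffleP. Qed.

Lemma integ_shift (f : shuffle R) : f 0%N = 0 -> integ (shift f) = f.
Proof. by move=> f0; apply: shuffleP => -[|n] /=. Qed.

End Integral.

Section LogBound.
Variables (m : nat) (K : fieldType).
Local Notation p := m.+1.
Hypothesis pK : p \in [pchar K].
Variables (n : nat) (u : 'I_n -> shuffle K).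
Hypothesis u_sect :
  forall k f, (k < p)%N -> lspan u f -> lspan u (sect p k f).
Implicit Types f g : shuffle K.

Lemma shuf_expp1 f : f 0%N = 1 -> f ^+ p = 1.
Proof. by move=> f0; rewrite (shuf_expp pK) f0 expr1n scale1r. Qed.

(** Since B^p = 1 and m = p - 1, the inverse of B is B^m. The antiderivative of B' B^m is thus a
    preimage of B under [exp_fact]. *)
Lemma log_factP (B : series K) : B 0%N = 1 ->
  log_fact B 0%N = 0 /\ exp_fact (log_fact B) = B.
Proof.
move=> B0; pose sB := to_shuf B; pose L := integ (shift sB * sB ^+ m).
apply: (@xgetI _ 0 [set A : series K | A 0%N = 0 /\ exp_fact A = B] (of_shuf L)).
split=> //; suff <- : of_shuf sB = B.
  apply: seriesP; have : sexp L =1 sB; last by [].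
  have -> // : sexp L = sB; apply: (shift_eq_unique (a := shift L)).
  - by rewrite sexp0.
  - exact: shift_sexp.
  - by rewrite shift_integ -mulrA -exprSr shuf_expp1 ?mulr1.
exact: to_shufK.
Qed.

Lemma shift_log f g : f 0%N = 1 -> shift f = g * f -> g = shift f * f ^+ m.
Proof. by move=> f0 ->; rewrite -mulrA -exprS shuf_expp1 // mulr1. Qed.

Definition shuf_prod l (t : l.-tuple 'I_n) : shuffle K := \prod_(i <- t) u i.

Let prods l := lspan (@shuf_prod l).

Let prods_mul l f g : lspan u f -> prods l g -> prods l.+1 (f * g).
Proof.
move=> [c ->] [d ->]; rewrite mulr_suml; apply: lspan_sum => i.
rewrite mulr_sumr; apply: lspan_sum => t; rewrite -scalerAl -scalerAr.
apply/lspanZ/lspanZ; have := lspan_id (@shuf_prod _) (cons_tuple i t).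
by rewrite {2}/shuf_prod big_cons.
Qed.

Let prods_exp l f : lspan u f -> prods l (f ^+ l).
Proof.
move=> uf; elim: l => [|l IHl]; last by rewrite exprS; apply: prods_mul.
have := lspan_id (@shuf_prod _) [tuple].
by rewrite {2}/shuf_prod big_nil.
Qed.

Let prods_sect l k f : (k < p)%N -> prods l f -> prods l (sect p k f).
Proof.
move=> ltkp; suff mono_sect (t : l.-tuple 'I_n) : prods l (sect p k (shuf_prod t)).
  move=> [c ->]; rewrite (raddf_sum (sect p k)); apply: lspan_sum => t.
  by rewrite /= sectZ; apply/lspanZ/mono_sect.
elim: l k ltkp t => [|l IHl] k ltkp t.
  rewrite (tuple0 t) /shuf_prod big_nil (sect1 pK).
  by case: eqP => _; [apply: (prods_exp 0 (lspan0 u))|exact: lspan0].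
case/tupleP: t => i t; rewrite /shuf_prod big_cons (sectM pK).
apply: lspan_sum => r; apply/lspanMn/prods_mul.
  by apply: u_sect; [move: (ltn_ord r); lia|exact: lspan_id].
by apply: IHl; lia.
Qed.

(** Up to a multiple of X, [f] is the logarithm of some [B] in the span. The constant [c] absorbs
    the Jacobson term created by each section. *)
Definition log_like f : Prop := f 0%N = 0 /\ exists B c,
  [/\ lspan u B, B 0%N = 1 & shift f = shift B * B ^+ m + c *: 1].

(** With a = f - cX one has B' = a'B, so [shift_sect_exp] gives the logarithmic derivative of
    [sect p 0 B]; its Jacobson term becomes the new constant. *)
Let log_like_sect0 f : log_like f -> log_like (sect p 0 f).
Proof.
move=> [f0 [B [c [uB B0 df]]]]; split; first by rewrite sectE.
pose a := f - c *: svar K.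
exists (sect p 0 B), (- (a 1%N ^+ p)); split; rewrite ?sectE //.
  exact: u_sect.
have dB : shift B = shift a * B.
  rewrite raddfB /= linearZ /= shift_svar df addrK.
  by rewrite -mulrA -exprSr shuf_expp1 ?mulr1.
have := shift_sect_exp pK dB.
move/shift_log => <-; last by rewrite sectE.
rewrite (raddfB (sect p 0)) /= sectZ (sect_svar pK) scaler0 subr0.
by rewrite scaleNr addrK.
Qed.

Let log_like_sect k f : (k.+1 < p)%N -> log_like f -> prods p (sect p k.+1 f).
Proof.
move=> ltkp [f0 [B [c [uB B0 df]]]]; rewrite -sect_shift df sectD sectZ.
apply: lspanD; last first.
  apply: lspanZ; rewrite (sect1 pK); case: eqP => _; last exact: lspan0.
  (* The constant 1 is itself the p-fold product B^p. *)
  by rewrite -(shuf_expp1 B0); apply: prods_exp.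
rewrite (sectM pK); apply: lspan_sum => i; apply/lspanMn/prods_mul.
  by rewrite sect_shift; apply: u_sect => //; move: (ltn_ord i); lia.
by apply: prods_sect; [lia|exact: prods_exp].
Qed.

Lemma kappa_log_fact (B : series K) : B 0%N = 1 -> lspan u (to_shuf B) ->
  fin_dim (pkernel p (log_fact B)) /\
  (kappa p (log_fact B) <= 1 + 2 * n ^ p)%N.
Proof.
(* The three families have 1, [n ^ p] and [n * n ^ m] members, which gives 1 + 2 n^p. The last one
   consists of antiderivatives for the [log_like] series. *)
move=> B0 uB; pose w (i : unit + (p.-tuple 'I_n + 'I_n * m.-tuple 'I_n)) :=
  match i with
  | inl _ => svar K
  | inr (inl t) => shuf_prod t
  | inr (inr (r, t)) => integ (shift (u r) * shuf_prod t)
  end.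
have SL : log_like (to_shuf (log_fact B)) \/ prods p (to_shuf (log_fact B)).
  left; have [L0 expL] := log_factP B0; split=> //.
  exists (to_shuf B), 0; split=> //; rewrite scale0r addr0.
  by apply: shift_log => //; rewrite -[in LHS]expL shift_exp_fact expL.
have [||fd le] := @kappa_leq p K (ltn0Sn m) (log_fact B)
    (fun f => log_like f \/ prods p f) _ w SL.
- move=> k f ltkp [fl|fp]; last by right; apply: prods_sect.
  by case: k ltkp => [|k] ltkp; [left; apply: log_like_sect0|
    right; apply: log_like_sect].
- move=> f [[f0 [D [c [[d DE] D0 df]]]]|]; last first.
    by apply: lspan_sub => t; apply: (lspan_id w (inr (inl t))).
  rewrite -(integ_shift f0) df linearD linearZ /=; apply: lspanD; last first.
    apply: lspanZ; have -> : integ 1 = svar K; last exact: (lspan_id w (inl tt)).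
    by apply: shuffleP => -[].
  have [e ->] : prods m (D ^+ m) by apply: prods_exp; exists d.
  rewrite {1}DE linear_sum mulr_suml linear_sum; apply: lspan_sum => r.
  rewrite linearZ /= -scalerAl linearZ; apply: lspanZ.
  rewrite mulr_sumr linear_sum; apply: lspan_sum => t.
  rewrite -scalerAr linearZ; apply: lspanZ.
  exact: (lspan_id w (inr (inr (r, t)))).
split=> //; move: le.
by rewrite !card_sum card_unit card_prod !card_tuple card_ord -expnS mul2n addnn.
Qed.

End LogBound.

(** * Christol's theorem *)

HB.instance Definition _ (R : comNzRingType) :=
  GRing.Lalgebra_isComAlgebra.Build R (series R).

Fact poly_series_is_zmod_morphism (R : nzRingType) :
  zmod_morphism (@poly_series R).
Proof. by move=> a b; apply: seriesP => n; rewrite /= coefB. Qed.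

HB.instance Definition _ (R : nzRingType) := GRing.isZmodMorphism.Build
  {poly R} (series R) (@poly_series R) (@poly_series_is_zmod_morphism R).

Fact poly_series_is_monoid_morphism (R : nzRingType) :
  monoid_morphism (@poly_series R).
Proof.
split=> [|a b]; apply: seriesP => n; first by rewrite /= coef1.
by rewrite /= coefM.
Qed.

HB.instance Definition _ (R : nzRingType) := GRing.isMonoidMorphism.Build
  {poly R} (series R) (@poly_series R) (@poly_series_is_monoid_morphism R).

Section SeriesField.
Variable K : fieldType.
Implicit Types F G H : series K.

Lemma series_sum (I : finType) (F : I -> series K) n :
  (\sum_i F i) n = \sum_i F i n.
Proof. by elim/big_rec2: _ => [|i y f _ <-] //; rewrite scoefD. Qed.

(** The lowest non-zero coefficient of [F] forces those of [G] to vanish one after another. *)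
Lemma mulps_eq0 F G : F != 0 -> F * G = 0 -> G = 0.
Proof.
move=> F0 FG0.
have exF : exists n, F n != 0.
  apply: contrapT => /forallNP F00; case/eqP: F0; apply: seriesP => l.
  by apply/eqP/negPn/negP/F00.
case: (ex_minnP exF) => n Fn n_min.
apply: seriesP; elim/ltn_ind => l IHl.
have : (F * G) (n + l)%N = 0 by rewrite FG0.
have ltn : (n < (n + l).+1)%N by lia.
rewrite scoefM (bigD1 (Ordinal ltn)) //= addKn big1 ?addr0 => [/eqP|i ni].
  by rewrite mulf_eq0 (negPf Fn) => /eqP.
have [ltin|leni] := ltnP i n.
  have [->|/n_min] := eqVneq (F i) 0; first by rewrite mul0r.
  by rewrite leqNgt ltin.
rewrite IHl ?scoef0 ?mulr0 //.
have : (i != n :> nat) by apply: contra ni => /eqP ni; apply/eqP/val_inj.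
by move: (ltn_ord i); lia.
Qed.

Definition mulps_left G H : series K := G * H.

Fact mulps_left_is_linear G : linear (mulps_left G).
Proof.
move=> x F H; rewrite /mulps_left mulrDr; congr (_ + _).
by rewrite mulrC -scalerAl mulrC.
Qed.

HB.instance Definition _ G := GRing.isLinear.Build K (series K) (series K)
  *:%R (mulps_left G) (mulps_left_is_linear G).

Lemma mulps_left_inj G : G != 0 -> injective (mulps_left G).
Proof.
move=> G0 F H /eqP; rewrite -subr_eq0 -(raddfB (mulps_left G)) => /eqP FH.
by apply/eqP; rewrite -subr_eq0; apply/eqP/(mulps_eq0 G0).
Qed.

Lemma poly_series_eq0 (c : {poly K}) : (poly_series c == 0) = (c == 0).
Proof.
apply/eqP/eqP => [c0|->]; last exact: rmorph0.
by apply/polyP => n; rewrite coef0; apply: (congr1 (fun F : series K => F n) c0).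
Qed.

Lemma mulXps H n : (poly_series 'X * H) n = if n is n'.+1 then H n' else 0.
Proof.
case: n => [|n]; first by rewrite scoefM big_ord1 /= coefX mul0r.
rewrite scoefM big_ord_recl /= coefX mul0r add0r big_ord_recl /= coefX mul1r.
by rewrite subSS subn0 big1 ?addr0 // => i _; rewrite coefX mul0r.
Qed.

Lemma mulXnps H k n : (poly_series 'X ^+ k * H) n =
  if (n < k)%N then 0 else H (n - k)%N.
Proof.
elim: k n => [|k IHk] n; first by rewrite mul1r subn0.
by rewrite exprS -mulrA mulXps; case: n => //= n; rewrite IHk ltnS subSS.
Qed.

End SeriesField.

Lemma expp_pchar_D p (R : comNzRingType) (x y : R) i : p \in [pchar R] ->
  (x + y) ^+ (p ^ i) = x ^+ (p ^ i) + y ^+ (p ^ i).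
Proof.
move=> pR; have p_prime : prime p by case/andP: pR.
by rewrite exprDn_pchar // pnatX pnatE ?pR.
Qed.

Section Christol.
Variables (p : nat) (K : fieldType) (r : K -> K).
Hypotheses (pK : p \in [pchar K]) (r_expp : forall x, r x ^+ p = x).
Implicit Types F G H : series K.

Let p_prime : prime p. Proof. by case/andP: pK. Qed.
Let p_gt0 : (0 < p)%N. Proof. exact: prime_gt0. Qed.
Let p_gt1 : (1 < p)%N. Proof. exact: prime_gt1. Qed.

Lemma pchar_series : p \in [pchar (series K)].
Proof.
rewrite inE /= p_prime; apply/eqP/seriesP => n.
rewrite -[p%:R]mulr1 mulr_natl scoef0.
have -> (T : series K) l i : (T *+ l) i = T i *+ l.
  by elim: l => // l IHl; rewrite !mulrS scoefD IHl.
by rewrite -mulr_natr (pcharf0 pK) mulr0.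
Qed.

Lemma expp_inj : injective (fun x : K => x ^+ p).
Proof.
move=> x y /= /eqP; rewrite -subr_eq0.
have := expp_pchar_D (x - y) y 1 pK; rewrite expn1 subrK => ->.
by rewrite addrK expf_eq0 p_gt0 /= subr_eq0 => /eqP.
Qed.

Let rD x y : r (x + y) = r x + r y.
Proof.
apply: expp_inj => /=; rewrite r_expp.
by have := expp_pchar_D (r x) (r y) 1 pK; rewrite expn1 !r_expp.
Qed.

Let rM x y : r (x * y) = r x * r y.
Proof. by apply: expp_inj => /=; rewrite exprMn !r_expp. Qed.

Let r0 : r 0 = 0.
Proof. by apply: expp_inj => /=; rewrite r_expp expr0n (gtn_eqF p_gt0). Qed.

(* Applying the inverse [r] of Frobenius to the coefficients makes [cartierM] hold
   without a twist of [F], at the price of semilinearity. *)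
Definition cartier k H : series K := Series (fun n => r (H (k + n * p)%N)).

Lemma cartierD k G H : cartier k (G + H) = cartier k G + cartier k H.
Proof. by apply: seriesP => n /=; rewrite rD. Qed.

Lemma cartier0 k : cartier k 0 = 0.
Proof. by apply: seriesP => n /=. Qed.

Lemma cartierE k H n : cartier k H n = r (H (k + n * p)%N).
Proof. by []. Qed.

Let cartierZ k x H : cartier k (x ^+ p *: H) = x *: cartier k H.
Proof.
apply: seriesP => n; rewrite cartierE !scoefZ rM; congr (_ * _).
by apply: expp_inj; rewrite /= r_expp.
Qed.

Let cartierXp k H : (k < p)%N ->
  cartier k (poly_series 'X ^+ p * H) = poly_series 'X * cartier k H.
Proof.
move=> ltkp; apply: seriesP => -[|n]; rewrite mulXps cartierE mulXnps.
  by rewrite mul0n addn0 ltkp.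
by rewrite ifF ?mulSn ?cartierE; [congr (r (H _)); lia|lia].
Qed.

(** Write F = F(0) + X F', so that F^p = F(0)^p + X^p F'^p; semilinearity treats the first term, and
    the factor X gained from X^p allows induction on the coefficient. *)
Lemma cartierM k F G : (k < p)%N ->
  cartier k (F ^+ p * G) = F * cartier k G.
Proof.
move=> ltkp; apply: seriesP => n; elim: n F => [|n IHn] F.
all: pose F' : series K := Series (fun n => F n.+1).
all: have FE : F = F 0%N *: 1 + poly_series 'X * F' by
  apply: seriesP => -[|l]; rewrite scoefD scoefZ mulXps scoef1 /=;
    [rewrite mulr1 addr0|rewrite mulr0 add0r].
all: have FpE : F ^+ p = F 0%N ^+ p *: 1 + poly_series 'X ^+ p * F' ^+ p by
  rewrite {1}FE; have := @expp_pchar_D p (series K) (F 0%N *: 1) (poly_series 'X * F') 1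
    pchar_series; rewrite expn1 => ->; rewrite exprMn exprZn expr1n.
all: have CE : cartier k (F ^+ p * G) =
    F 0%N *: cartier k G + poly_series 'X * cartier k (F' ^+ p * G) by
  rewrite FpE mulrDl -mulrA cartierD -scalerAl mul1r cartierZ cartierXp.
- by rewrite CE [in RHS]FE mulrDl !scoefD -scalerAl mul1r -mulrA !mulXps.
by rewrite CE [in RHS]FE mulrDl !scoefD -scalerAl mul1r -mulrA !mulXps IHn.
Qed.

Lemma cartier_sum k (I : finType) (F : I -> series K) :
  cartier k (\sum_i F i) = \sum_i cartier k (F i).
Proof.
elim/big_rec2: _ => [|i y f _ <-]; first exact: cartier0.
by rewrite cartierD.
Qed.

Definition cartier_poly k (c : {poly K}) : {poly K} :=
  \poly_(i < size c) r c`_(k + i * p).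

Lemma cartier_polyE k c :
  cartier k (poly_series c) = poly_series (cartier_poly k c).
Proof.
apply: seriesP => n; rewrite cartierE /= coef_poly; case: ltnP => // len.
rewrite nth_default ?r0 //; apply: leq_trans len _.
by rewrite -[leqLHS]muln1; apply: leq_trans (leq_addl _ _);
  rewrite leq_mul2l p_gt0 orbT.
Qed.

(** Because p >= 2, a Cartier operator at least halves the size. *)
Lemma size_cartier_poly k (c : {poly K}) N : (size c <= N + N)%N ->
  (size (cartier_poly k c) <= N)%N.
Proof.
move=> sc; apply/leq_sizeP => l leNl; rewrite coef_poly; case: ifP => // _.
rewrite nth_default ?r0 //; apply: leq_trans sc _.
apply: leq_trans (leq_addl _ _); rewrite addnn -muln2.
exact: leq_mul.
Qed.

(** If [P 0] vanishes, every remaining power of [A] is a p-th power, and a Cartier operator lowers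
    all Frobenius exponents by one. *)
Lemma frobenius_relation_reduce (A : series K) m (P : nat -> {poly K}) :
  (exists2 i, (i <= m)%N & P i != 0) ->
  \sum_(i < m.+1) poly_series (P i) * A ^+ (p ^ i) = 0 ->
  exists m (P : nat -> {poly K}), P 0%N != 0 /\
    \sum_(i < m.+1) poly_series (P i) * A ^+ (p ^ i) = 0.
Proof.
elim: m P => [|m IHm] P [i leim Pi] PA.
  by exists 0%N, P; split=> //; move: leim Pi; rewrite leqn0 => /eqP ->.
have [P0|P0] := eqVneq (P 0%N) 0; last by exists m.+1, P.
have [i' iE] : exists i', i = i'.+1.
  by case: i leim Pi => [|i'] _ Pi; [rewrite P0 eqxx in Pi|exists i'].
have Pl : lead_coef (P i) != 0 by rewrite lead_coef_eq0.
(* This residue keeps the leading coefficient of [P i], which moves to index [l %/ p], so the new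
   relation is non-trivial. *)
pose l := (size (P i)).-1; pose k := (l %% p)%N.
apply: (IHm (fun i => cartier_poly k (P i.+1))).
  exists i'; first by move: leim; rewrite iE.
  apply/eqP => /(congr1 (fun c : {poly K} => (poly_series c) (l %/ p)%N)).
  rewrite -cartier_polyE cartierE rmorph0 addnC -divn_eq -iE => /= rl.
  by move: Pl; rewrite /lead_coef -[_`_ _]r_expp -/l rl expr0n (gtn_eqF p_gt0) eqxx.
move: PA; rewrite big_ord_recl P0 rmorph0 mul0r add0r => PA.
rewrite -[RHS](cartier0 k) -[in RHS]PA cartier_sum; apply: eq_bigr => l' _.
rewrite lift0 -cartier_polyE expnSr exprM mulrC -cartierM ?ltn_mod //.
by rewrite mulrC.
Qed.

(** With d the degree of [P], the d + 1 powers A^(p^i) reduce modulo [P] to a space of dimension d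
    over K(X). Pseudo-division supplies the factors [s i] that clear denominators. *)
Lemma algebraic_frobenius_relation (A : series K) : algebraic_series A ->
  exists m (P : nat -> {poly K}), P 0%N != 0 /\
    \sum_(i < m.+1) poly_series (P i) * A ^+ (p ^ i) = 0.
Proof.
move=> [P P0 /rootP PA0].
pose ev (c : {poly {poly K}}) : series K := (map_poly (@poly_series K) c).[A].
have evM : {morph ev : a b / a * b} by move=> a b; rewrite /ev rmorphM hornerM.
have evD : {morph ev : a b / a + b} by move=> a b; rewrite /ev rmorphD hornerD.
have evC c : ev c%:P = poly_series c by rewrite /ev map_polyC hornerC.
have evX i : ev 'X^i = A ^+ i by rewrite /ev map_polyXn hornerXn.
have [d dE] : exists d, size P = d.+1.
  by exists (size P).-1; rewrite prednK // size_poly_gt0.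
pose E i : {poly {poly K}} := 'X^(p ^ i) %% P.
pose s i := lead_coef P ^+ scalp 'X^(p ^ i) P.
have EE i : poly_series (s i) * A ^+ (p ^ i) = ev (E i).
  rewrite -evC -evX -evM mul_polyC /s.
  rewrite [X in ev X](Pdiv.Idomain.divp_eq 'X^(p ^ i) P) evD evM.
  by rewrite [ev P]PA0 mulr0 add0r.
have sE i l : (d <= l)%N -> (E i)`_l = 0.
  move=> ledl; apply: nth_default; apply: leq_trans ledl.
  by rewrite -ltnS -dE ltn_modp.
(* The remainders have degree below d, so the last column is zero and the determinant vanishes. *)
pose M : 'M[{poly K}]_d.+1 := \matrix_(i, l) (E i)`_l.
have /eqP/det0P[v v0 vM] : \det M = 0.
  rewrite (expand_det_col _ ord_max) big1 // => i _.
  by rewrite mxE sE ?mul0r.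
have [i0 vi0] : exists i, v 0 i != 0.
  apply: contrapT => /forallNP nv; case/eqP: v0; apply/rowP => i.
  by rewrite mxE; apply/eqP/negPn/negP/nv.
pose w i := v 0 (inord i).
apply: (@frobenius_relation_reduce A d (fun i => w i * s i)).
  exists i0; first by rewrite -ltnS.
  rewrite mulf_neq0 ?expf_neq0 ?lead_coef_eq0 //.
  by rewrite /w inord_val.
have wE0 : \sum_(i < d.+1) (w i)%:P * E i = 0.
  apply/polyP => l; rewrite coef_sum coef0.
  have [ledl|ltld] := leqP d l.
    by rewrite big1 // => i _; rewrite coefCM sE ?mulr0.
  have /rowP/(_ (inord l)) := vM; rewrite !mxE => vMl; rewrite -[RHS]vMl.
  apply: eq_bigr => i _; by rewrite coefCM mxE /w inord_val inordK // ltnW.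
have ev_sum (F : 'I_d.+1 -> {poly {poly K}}) : ev (\sum_i F i) = \sum_i ev (F i).
  elim/big_rec2: _ => [|i y f _ <-]; last by rewrite evD.
  by rewrite /ev rmorph0 horner0.
transitivity (ev (\sum_(i < d.+1) (w i)%:P * E i)).
  rewrite ev_sum; apply: eq_bigr => i _.
  by rewrite rmorphM -mulrA EE evM evC.
by rewrite wE0 /ev rmorph0 horner0.
Qed.

End Christol.

(** * A finite-dimensional space stable under Cartier operators *)

Section CartierSpace.
Variables (p : nat) (K : fieldType) (r : K -> K).
Hypotheses (pK : p \in [pchar K]) (r_expp : forall x, r x ^+ p = x).

Let p_prime : prime p. Proof. by case/andP: pK. Qed.
Let p_gt0 : (0 < p)%N. Proof. exact: prime_gt0. Qed.
Let p_gt1 : (1 < p)%N. Proof. exact: prime_gt1. Qed.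

(* Multiplying by [Q ^+ (p ^ m.+1)] avoids the Laurent series [A / Q], in terms
   of which [W] is spanned by bounded multiples of [(A / Q) ^+ (p ^ i)]. *)
Lemma christol_cartier_stable (A : series K) : algebraic_series A ->
  exists (W : set (series K)) (n : nat) (w : 'I_n -> series K),
  [/\ W A, forall k H, (k < p)%N -> W H -> W (cartier p r k H) &
      forall H, W H -> lspan w H].
Proof.
move=> A_alg.
have [m [P [P0 PA]]] := algebraic_frobenius_relation pK r_expp A_alg.
pose Q := poly_series (P 0%N); pose R i := - P i.+1.
have QA : Q * A = \sum_(i < m) poly_series (R i) * A ^+ (p ^ i.+1).
  move: PA; rewrite big_ord_recl expn0 expr1 => /eqP; rewrite addr_eq0 => /eqP ->.
  rewrite -sumrN; apply: eq_bigr => i _.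
  by rewrite lift0 /R rmorphN mulNr.
have leX i l : (i <= l)%N -> (p ^ i <= p ^ l)%N by move=> ?; rewrite leq_pexp2l.
pose T i := Q ^+ (p ^ m.+1 - p ^ i) * A ^+ (p ^ i).
(* Substituting [QA] in [T 0] gives it the coefficient [D i] on [T i.+1]. *)
pose D i : {poly K} := R i * P 0%N ^+ (p ^ i.+1 - 2).
(* The bound covers [P 0], so that [A] lies in [W], and all [D i]: the products [c 0 * D i] then
   have size at most 2N, which Cartier operators bring back to N. *)
pose N := (size (P 0%N) + \sum_(i < m) size (D i))%N.
have sD i : (i < m)%N -> (size (D i) <= N)%N.
  move=> ltim; apply: leq_trans (leq_addl _ _).
  by rewrite (bigD1 (Ordinal ltim)) //= leq_addr.
pose W : set (series K) := fun H => exists2 c : nat -> {poly K},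
  forall i, (size (c i) <= N)%N &
  Q ^+ (p ^ m.+1) * H = \sum_(i < m.+1) poly_series (c i) * T i.
have Wcartier k H : (k < p)%N -> W H -> W (cartier p r k H).
  move=> ltkp [c sc HE].
  pose c' i := c i.+1 + c 0%N * D i.
  have sc' i : (i < m)%N -> (size (c' i) <= N + N)%N.
    move=> ltim; apply: leq_trans (size_polyD _ _) _; rewrite geq_max.
    rewrite (leq_trans (sc _)) ?leq_addr //=.
    apply: leq_trans (size_polyMleq _ _) _; apply: leq_trans (leq_pred _) _.
    by apply: leq_add; [exact: sc|exact: sD].
  (* By construction [T i.+1] is [U i ^+ p], so [cartierM] applies. *)
  pose U i := Q ^+ (p ^ m - p ^ i) * A ^+ (p ^ i).
  have HE' : Q ^+ (p ^ m.+1) * H = \sum_(i < m) poly_series (c' i) * U i ^+ p.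
    rewrite HE big_ord_recl /= /T expn0 expr1.
    have -> : Q ^+ (p ^ m.+1 - 1) = Q ^+ (p ^ m.+1 - 2) * Q.
      rewrite -exprSr; congr (_ ^+ _).
      have : (p ^ 1 <= p ^ m.+1)%N by exact: leX.
      by rewrite expn1; lia.
    rewrite -[X in _ * X + _]mulrA QA !mulr_sumr -big_split; apply: eq_bigr => i _.
    rewrite /= /bump add1n /c' rmorphD mulrDl addrC /U exprMn -!exprM mulnBl -!expnSr.
    congr (_ + _); rewrite /D !rmorphM rmorphXn /= -/Q.
    have -> : Q ^+ (p ^ m.+1 - 2) =
        Q ^+ (p ^ i.+1 - 2) * Q ^+ (p ^ m.+1 - p ^ i.+1).
      rewrite -exprD; congr (_ ^+ _).
      have : (p ^ 1 <= p ^ i.+1)%N by exact: leX.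
      have : (p ^ i.+1 <= p ^ m.+1)%N by apply: leX; rewrite ltnS ltnW.
      by rewrite expn1; move: p_gt1; lia.
    by ring.
  pose d i := if (i < m)%N then cartier_poly p r k (c' i) else 0.
  exists d => [i|].
    rewrite /d; case: ifP => ltim; last by rewrite size_poly0.
    exact/size_cartier_poly/sc'.
  rewrite big_ord_recr /= {2}/d ltnn rmorph0 mul0r addr0.
  have QE : Q ^+ (p ^ m) * cartier p r k H =
      \sum_(i < m) poly_series (cartier_poly p r k (c' i)) * U i.
    rewrite -cartierM // -exprM -expnSr HE' cartier_sum //.
    apply: eq_bigr => i _.
    by rewrite mulrC cartierM // -cartier_polyE // mulrC.
  have -> : Q ^+ (p ^ m.+1) = Q ^+ (p ^ m.+1 - p ^ m) * Q ^+ (p ^ m).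
    by rewrite -exprD subnK // leX.
  rewrite -mulrA QE mulr_sumr; apply: eq_bigr => i _.
  rewrite /d ltn_ord /T /U.
  have -> : (p ^ m.+1 - p ^ i = (p ^ m.+1 - p ^ m) + (p ^ m - p ^ i))%N.
    have := leX m m.+1 (leqnSn _); have := leX i m (ltnW (ltn_ord i)); lia.
  by rewrite exprD; ring.
have WA : W A.
  exists (fun i => if i is 0%N then P 0%N else 0) => [[|i]|].
  - exact: leq_addr.
  - by rewrite size_poly0.
  rewrite big_ord_recl big1 ?addr0 => [|i _]; last by rewrite rmorph0 mul0r.
  rewrite /T expn0 expr1 mulrA -exprS; congr (Q ^+ _ * _).
  by rewrite subn1 prednK // expn_gt0 p_gt0.
have Q0 : Q ^+ (p ^ m.+1) != 0.
  elim: (p ^ m.+1)%N => [|l IHl]; first by rewrite expr0 oner_neq0.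
  apply/eqP; rewrite exprS => /mulps_eq0; rewrite poly_series_eq0 => /(_ P0).
  exact/eqP.
have Wspan H : W H -> lspan (fun i : 'I_m.+1 * 'I_N => poly_series 'X^(i.2) * T i.1)
    (mulps_left (Q ^+ (p ^ m.+1)) H).
  move=> [c sc]; rewrite /mulps_left => ->; apply: lspan_sum => i.
  have -> : poly_series (c i) = \sum_(l < N) (c i)`_l *: poly_series 'X^l.
    apply: seriesP => l; rewrite series_sum /=.
    have [ltlN|leNl] := ltnP l N; last first.
      rewrite nth_default ?(leq_trans (sc i)) // big1 // => l' _.
      rewrite coefXn; case: eqP => [ll'|]; last by rewrite mulr0.
      by move: leNl; rewrite ll' leqNgt ltn_ord.
    rewrite (bigD1 (Ordinal ltlN)) //= coefXn eqxx mulr1 big1 ?addr0 // => l' ll'.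
    rewrite coefXn; case: eqP => [l'E|]; last by rewrite mulr0.
    by case/eqP: ll'; apply: val_inj.
  rewrite mulr_suml; apply: lspan_sum => l; rewrite -scalerAl; apply: lspanZ.
  exact: (lspan_id (fun i : 'I_m.+1 * 'I_N => poly_series 'X^(i.2) * T i.1) (i, l)).
have [n _ [w _ wE]] := span_has_dim (@mulps_left_inj _ _ Q0) Wspan.
exists W, n, w; split=> // H WH.
by rewrite -span_set_range -wE; apply: span_set_id.
Qed.

Variables (e : nat) (Fq : finFieldType) (j : {rmorphism Fq -> K}).
Hypotheses (card_Fq : #|Fq| = (p ^ e)%N).

(** Sections are Cartier operators up to a Frobenius twist. On coefficients in F_q the twist has
    period e, so finitely many twists of the stable space suffice. *)
Lemma christol_pkernel (A : series K) : algebraic_series A ->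
  (forall n, exists a : Fq, A n = j a) -> fin_dim (pkernel p A).
Proof.
move=> A_alg A_coef.
have [W [n [w [WA Wcartier Wspan]]]] := christol_cartier_stable A_alg.
have e_gt0 : (0 < e)%N.
  by rewrite lt0n; apply/eqP => e0; have := finNzRing_gt1 Fq; rewrite card_Fq e0.
pose twist i (f : shuffle K) : series K := Series (fun l => iter i r (f l)).
pose S : set (shuffle K) := fun f => (forall l, exists a, f l = j a) /\
  exists i : 'I_e, W (twist i f).
have iter_r i x : iter i r x ^+ (p ^ i) = x.
  by elim: i => //= i IHi; rewrite expnS exprM r_expp.
have expX_inj i : injective (fun x : K => x ^+ (p ^ i)).
  elim: i => [|i IHi] x y //=; rewrite !expnSr !exprM => /(expp_inj pK); exact: IHi.
have r_e a : iter e r (j a) = j a.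
  by apply: (expX_inj e); rewrite iter_r -rmorphXn -card_Fq expf_card.
have SA : S (to_shuf A).
  split=> //; exists (Ordinal e_gt0).
  by have -> : twist (Ordinal e_gt0) (to_shuf A) = A by exact: seriesP.
have Ssect k f : (k < p)%N -> S f -> S (sect p k f).
  move=> ltkp [fj [i Wf]]; split=> [l|]; first by rewrite sectE; apply: fj.
  have Wf' : W (twist i.+1 (sect p k f)) by exact: (Wcartier k _ ltkp Wf).
  have [lt|le] := ltnP i.+1 e; first by exists (Ordinal lt).
  exists (Ordinal e_gt0).
  have <- // : twist i.+1 (sect p k f) = twist (Ordinal e_gt0) (sect p k f).
  (* The e-th iterate of [r] fixes F_q, so the twist index wraps around to 0. *)
  have -> : i.+1 = e by apply/eqP; rewrite eqn_leq le ltn_ord.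
  by apply: seriesP => l; have [a aE] := fj (k + l * p)%N; rewrite /twist /= aE r_e.
(* Frobenius powers of the coefficients undo the twist and preserve sums. *)
pose v (il : 'I_e * 'I_n) : shuffle K := Shuffle (fun l => w il.2 l ^+ (p ^ il.1)).
have Sv f : S f -> lspan v f.
  move=> [_ [i /Wspan[c cE]]].
  have -> : f = \sum_l c l ^+ (p ^ i) *: v (i, l).
    apply: shuffleP => l; rewrite shuf_sum -[LHS](iter_r i).
    have -> : iter i r (f l) = twist i f l by [].
    rewrite cE series_sum; elim/big_rec2: _ => [|l' y z _ <-].
      by rewrite expr0n expn_eq0 (gtn_eqF p_gt0).
    by rewrite (expp_pchar_D _ _ i pK) scoefZ exprMn.
  by apply: lspan_sum => l; apply/lspanZ/lspan_id.
by have [] := kappa_leq p_gt0 SA Ssect Sv.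
Qed.

End CartierSpace.

(** Sections of 1 are 0 or 1, so one extra generator suffices. *)
Lemma pkernel_add1 p (K : fieldType) (A : series K) : p \in [pchar K] ->
  fin_dim (pkernel p A) -> fin_dim (pkernel p (1 + A)).
Proof.
move=> pK [n /pkernel_shuffle].
have p_gt0 : (0 < p)%N by case/andP: pK => /prime_gt0.
move=> /(_ p_gt0)[u [uA u_sect]].
pose S : set (shuffle K) := fun f => exists c, lspan u (f - c *: 1).
pose w i := oapp u 1 i.
have [|||//] := @kappa_leq p K p_gt0 (1 + A) S _ w.
- exists 1; rewrite scale1r.
  by have -> : to_shuf (1 + A) - 1 = to_shuf A by
    apply: shuffleP => l; rewrite shufD shufN shuf1 /= addrC addKr.
- move=> k f ltkp [c uf]; exists (c * (k == 0%N)%:R).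
  have := u_sect k _ ltkp uf; rewrite (raddfB (sect p k)) /= sectZ (sect1 pK).
  by rewrite -scalerA; case: eqP; rewrite ?scale1r ?scale0r.
move=> f [c uf]; rewrite -[f](subrK (c *: 1)); apply: lspanD.
  by apply: lspan_sub uf => i; apply: (lspan_id w (Some i)).
exact/lspanZ/(lspan_id w None).
Qed.

Theorem theorem1p6 (p e q : nat) (p_prime : prime p) (q_def : q = (p ^ e)%N)
    (K : closedFieldType) (iota : {rmorphism 'F_p -> K})
    (K_alg_closure : integralRange iota)
    (Fq : finFieldType) (card_Fq : #|Fq| = q) (j : {rmorphism Fq -> K})
    (A : series K) (A_const : A 0%N = 0) (A_neq0 : A != 0)
    (A_alg : algebraic_series A) (A_coef : forall n, exists a : Fq, A n = j a) :
  [/\ fin_dim (pkernel p A), fin_dim (pkernel p (exp_fact A)) &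
      (kappa p (exp_fact A) <= q ^ (kappa p A - 1) * p ^ (q ^ kappa p A))%N] /\
  [/\ fin_dim (pkernel p (1 + A)), fin_dim (pkernel p (log_fact (1 + A))) &
      (kappa p (log_fact (1 + A)%R) <= 1 + 4 * kappa p (1 + A)%R ^ p)%N].
Proof.
have pK : p \in [pchar K].
  rewrite inE p_prime /= -(rmorph_nat iota) -(rmorph0 iota).
  by rewrite pcharf0 // pchar_Fp.
have p_gt0 := prime_gt0 p_prime.
(* Frobenius is surjective on an algebraically closed field; [r] is its inverse. *)
have /choice[r r_expp] : forall x : K, exists y, y ^+ p = x.
  move=> x.
  have [y yE] := @solve_monicpoly K p (fun i => if i == 0%N then x else 0) p_gt0.
  exists y; rewrite yE (bigD1 (Ordinal p_gt0)) //= expr0 mulr1.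
  rewrite big1 ?addr0 // => i i0.
  by rewrite (negPf (i0 : i != 0%N :> nat)) mul0r.
have fdA : fin_dim (pkernel p A).
  apply: (christol_pkernel pK r_expp (etrans card_Fq q_def) A_alg A_coef).
have fd1A := pkernel_add1 pK fdA.
split.
  have [u [uA u_sect]] := pkernel_shuffle p_gt0 (has_dim_dimension fdA).
  have [fdE [k_gt0 le_kE]] := kappa_exp_fact pK u_sect A_const A_neq0 A_coef uA.
  split=> //; apply: leq_trans le_kE _; rewrite card_Fq.
  apply: (exp_bound_leq p_prime q_def _ k_gt0).
  rewrite lt0n; apply/eqP => e0.
  by have := finNzRing_gt1 Fq; rewrite card_Fq q_def e0.
have [u [uA u_sect]] := pkernel_shuffle p_gt0 (has_dim_dimension fd1A).
case: p p_gt0 pK fd1A u uA u_sect {p_prime q_def iota K_alg_closure r_expp fdA}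
  => // m _ pK fd1A u uA u_sect.
have B0 : (1 + A) 0%N = 1 by rewrite scoefD scoef1 A_const addr0.
have [fdL le_kL] := kappa_log_fact pK u_sect B0 uA.
split=> //; apply: leq_trans le_kL _.
(* The bound obtained has the factor 2, below the stated 4. *)
by rewrite leq_add2l leq_mul2r orbT.
Qed.
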